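(* Let $A:X\to Y$ be a bounded linear operator between Banach spaces and let $0<\xi<\omega_1$. Then $A$ is $\mathcal S_\xi$-weakly compact if and only if $A\in\mathfrak{WC}^\xi$.
   Context: Schreier families: finite subsets of $\mathbb{N}$ are written in increasing order; $E<F$ means $\max E<\min F$, and $n\leqslant E$ means $n\leqslant\min E$. For families $\mathcal F,\mathcal G$ of finite subsets of $\mathbb N$, $\mathcal F[\mathcal G]=\{\bigcup_{i=1}^nE_i: E_1<\dots<E_n,\ (\min E_i)_{i=1}^n\in\mathcal F,\ E_i\in\mathcal G\}$. Let $\mathcal S=\{E: |E|\leqslant \min E\}\cup\{\varnothing\}$, $\mathcal S_0=\{\varnothing\}\cup\{\{n\}:n\in\mathbb N\}$, $\mathcal S_{\xi+1}=\mathcal S[\mathcal S_\xi]$, and for a countable limit ordinal $\xi$ fix successor ordinals $\xi_n\uparrow\xi$ with $\mathcal S_{\xi_n}\subset\mathcal S_{\xi_{n+1}}$ and let $\mathcal S_\xi=\{E:\exists\, n\leqslant E,\ E\in\mathcal S_{\xi_n}\}$ (together with $\varnothing$). Let $(s_i)$ be the summing basis, with norm $\|\sum_{i=1}^na_is_i\|=\max_{1\leqslant m\leqslant n}|\sum_{i=1}^ma_i|$. An operator $A:X\to Y$ is $\mathcal S_\xi$-weakly compact if for every seminormalized basic sequence $(x_n)\subset X$ and every $\varepsilon>0$ there exist $E\in\mathcal S_\xi$ and scalars $(a_i)_{i\in E}$ with $\|\sum_{i\in E}a_iAx_i\|<\varepsilon\|\sum_{i\in E}a_is_i\|$. A sequence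 $(x_i)$ in a Banach space is an $\ell_1^\xi$ spreading model if there are $a,b>0$ such that for all $E\in\mathcal S_\xi$ and scalars $(a_i)_{i\in E}$, $\sum_{i\in E}|a_i|\leqslant a\|\sum_{i\in E}a_ix_i\|$ and $\|\sum_{i\in E}a_ix_i\|\leqslant b\sum_{i\in E}|a_i|$. $\mathfrak{WC}^\xi$ is the class of weakly compact operators $A:X\to Y$ such that whenever $(x_n)\subset X$ is an $\ell_1^\xi$ spreading model, $(Ax_n)$ is not an $\ell_1^\xi$ spreading model. *)

(* Defs.v *)
From mathcomp Require Export all_boot all_order all_algebra.
From mathcomp Require Export finmap.
From mathcomp Require Export all_classical all_reals all_analysis.
From mathcomp Require Export complex.
Export Order.TTheory GRing.Theory Num.Theory.
Export numFieldNormedType.Exports.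

Set Implicit Arguments.
Unset Strict Implicit.
Unset Printing Implicit Defensive.

Open Scope classical_set_scope.
Open Scope ring_scope.

(* The natural numbers are 1, 2, 3, ...: families consist of finite sets of
   positive integers, and a sequence (x_n)_{n >= 1} is a function on nat whose
   value at 0 is never used. *)

(* An order satisfying [countable_ordinals] is isomorphic to an ordinal
   <= omega_1 (for instance omega_1 itself), so its elements stand for
   ordinals < omega_1. *)
Definition countable_ordinals (d : Order.disp_t) (T : orderType d) : Prop :=
  wochoice.well_order (@Order.le d T) /\
  forall x : T, countable [set y : T | (y < x)%O].

Section Ordinals.
Variables (d : Order.disp_t) (T : orderType d).

Definition is_zero (x : T) : Prop := forall y : T, (x <= y)%O.

Definition is_succ (x y : T) : Prop :=
  (x < y)%O /\ forall z : T, (x < z)%O -> (y <= z)%O.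

Definition is_limit (x : T) : Prop :=
  ~ is_zero x /\ ~ exists y : T, is_succ y x.

End Ordinals.

(* For E = fset0 this is 0 by default. *)
Definition fset_min (E : {fset nat}) : nat := head 0%N (sort leq E).

Definition fset_lt (E F : {fset nat}) : Prop :=
  forall i j : nat, i \in E -> j \in F -> (i < j)%N.

(* F[G]; since the minima of the E_i are required to exist, the E_i are
   nonempty. *)
Definition convolution (F G : set {fset nat}) : set {fset nat} :=
  [set E | exists (n : nat) (Es : 'I_n -> {fset nat}),
    [/\ forall i, Es i != fset0 /\ G (Es i),
        forall i j : 'I_n, (i < j)%N -> fset_lt (Es i) (Es j),
        F [fset fset_min (Es i) | i : 'I_n]%fset
      & E = (\bigcup_(i in 'I_n) Es i)%fset]].

Definition schreier : set {fset nat} :=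
  [set E | E = fset0 \/ (#|` E| <= fset_min E)%N].

Definition schreier0 : set {fset nat} :=
  [set E | E = fset0 \/ exists2 n : nat, (0 < n)%N & E = [fset n]%fset].

(* [S x] is the family S_x; for a limit x, (fs x n)_{n >= 1} is the fixed
   sequence of successor ordinals increasing to x. *)
Definition schreier_hierarchy (d : Order.disp_t) (T : orderType d)
    (fs : T -> nat -> T) (S : T -> set {fset nat}) : Prop :=
  [/\ forall x, is_zero x -> S x = schreier0,
      forall x y, is_succ x y -> S y = convolution schreier (S x)
    & forall x, is_limit x ->
      [/\ forall n, (0 < n)%N ->
            [/\ exists y, is_succ y (fs x n), (fs x n < x)%O,
                (fs x n < fs x n.+1)%O & S (fs x n) `<=` S (fs x n.+1)],
          forall y, (y < x)%O -> exists2 n, (0 < n)%N & (y < fs x n)%O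
        & S x = [set E | E = fset0 \/
                  exists n, [/\ (0 < n)%N, (n <= fset_min E)%N
                              & S (fs x n) E]]]].

(* The scalar field K is the field of real or of complex numbers. For complex
   K, norms are elements of K and [0 < e] says that e is a positive real. *)
Section BanachSpaces.
Variable K : numFieldType.

(* The norm of \sum_(i in E) a_i s_i. *)
Definition summing_norm (E : {fset nat}) (a : nat -> K) : K :=
  \big[Num.max/0]_(1 <= m < (\max_(i <- E) i).+1)
    `|\sum_(i <- E | (i <= m)%N) a i|.

Section Sequences.
Variable X : normedModType K.
Implicit Type x : nat -> X.

Definition partial_sum x (a : nat -> K) (n : nat) : X :=
  \sum_(1 <= i < n.+1) a i *: x i.

Definition closed_span x : set X :=
  closure [set v | exists n a, v = partial_sum x a n].

(* x is a Schauder basis of its closed linear span. *)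
Definition basic_sequence x : Prop :=
  forall v, closed_span x v ->
    exists a : nat -> K, (partial_sum x a n @[n --> \oo] --> v) /\
      forall b : nat -> K, (partial_sum x b n @[n --> \oo] --> v) ->
        forall n, (0 < n)%N -> b n = a n.

Definition seminormalized x : Prop :=
  exists c C : K, [/\ 0 < c, 0 < C
    & forall n, (0 < n)%N -> c <= `|x n| /\ `|x n| <= C].

(* F is the Schreier family S_xi. *)
Definition l1_spreading_model (F : set {fset nat}) x : Prop :=
  exists a b : K, [/\ 0 < a, 0 < b
    & forall (E : {fset nat}) (c : nat -> K), F E ->
        \sum_(i <- E) `|c i| <= a * `|\sum_(i <- E) c i *: x i| /\
        `|\sum_(i <- E) c i *: x i| <= b * \sum_(i <- E) `|c i|].

Definition dual : Type := {f : {linear X -> K^o} | continuous f}.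

Definition weak_eval (v : X) : {ptws dual -> K^o} := fun f => sval f v.

Definition weak_space : topologicalType := initial_topology weak_eval.

Definition relatively_weakly_compact (B : set X) : Prop :=
  compact (@closure weak_space B).

End Sequences.

Section Operators.
Variables X Y : normedModType K.

Definition bounded_operator (A : {linear X -> Y}) : Prop :=
  bounded_near A (nbhs (0 : X)).

Definition weakly_compact (A : {linear X -> Y}) : Prop :=
  relatively_weakly_compact (A @` [set x | `|x| <= 1]).

Definition S_weakly_compact (F : set {fset nat}) (A : {linear X -> Y}) : Prop :=
  forall x : nat -> X, seminormalized x -> basic_sequence x ->
  forall e : K, 0 < e ->
  exists (E : {fset nat}) (a : nat -> K), F E /\
    `|\sum_(i <- E) a i *: A (x i)| < e * summing_norm E a.

Definition WC (F : set {fset nat}) (A : {linear X -> Y}) : Prop :=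
  weakly_compact A /\
  forall x : nat -> X, l1_spreading_model F x ->
    ~ l1_spreading_model F (fun n => A (x n)).

End Operators.
End BanachSpaces.

(* Main.v *)
Require Import Defs.
From HB Require Import structures.
From mathcomp Require Import ring lra zify.

Set Implicit Arguments.
Unset Strict Implicit.
Unset Printing Implicit Defensive.

(** If an operator A is not S_xi-weakly compact, there are a seminormalized basic
    sequence (x_n) and e > 0 with |sum a_i A x_i| >= e |sum a_i s_i| for all
    supports in S_xi. Both implications turn on such lower estimates. Real and
    complex scalars are treated together, through [real_coordinates].

    S_xi-weakly compact implies WC. Suppose first that A is not weakly compact.
    An ultrafilter on the unit ball of X defines an element xs of the bidual of X
    whose image ys under the second adjoint of A is not in Y, hence is at positive
    distance from Y ([far_from_space]). Vectors x_1, x_2, ... of the ball are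
    selected so that x_i - xs and A x_i - ys are almost annihilated by finite sets
    of functionals that nearly norm the previous vectors ([mazur_selection]); then
    xs, x_1 - xs, x_2 - xs, ... is basic, and so is its image
    ([mazur_inequality]). In the bidual, sum a_i x_i is
    (sum a_i) xs + sum a_i (x_i - xs), and its k-th partial sum differs from an
    element of X by the k-th tail of sum a_i, times xs. The distance from xs to X
    therefore bounds the tails, which makes (x_i) basic, and the distance from ys
    to Y makes (A x_i) dominate the summing basis, a contradiction
    ([not_weakly_compact_sequence]). Suppose next that (x_n) and (A x_n) are l1
    spreading models of order xi. Finitely many functionals cannot tell apart some
    two late terms of a bounded sequence, so Mazur's selection gives a basic
    sequence of differences x_{p k} - x_{q k} ([difference_sequence]). Since S_xi
    is stable under replacing each element by two ([doubling]), their images have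
    a lower l1 estimate on S_xi, hence dominate the summing basis there
    ([S_weakly_compact_no_l1]).

    WC implies S_xi-weakly compact. Suppose that A is weakly compact and that
    (A x_n) dominates the summing basis on S_xi, and let y be a weak limit of
    (A x_n) along an ultrafilter. For E in S_xi, the values 1 on an initial segment
    of E and 0 on the rest of E are taken at the vectors A x_i by a functional of
    norm at most 1 / e ([leaf_functional]). Ordered by end-extension, S_xi is a
    well founded tree, and weak-star ultralimits transport these functionals from
    the maximal nodes down to all nodes s ([tree]). Because y is a weak limit,
    there is a fast sequence r such that for all nodes s contained in its range
    the functional f_s has nearly one and the same value c at y and at all
    A x_{r i} with r i outside s ([generic_functionals]). On A x_{r i} - A x_{r 0}
    it is then l - c, where l is the label 0 or 1 of r i, when r i belongs to s,
    and almost 0 otherwise. This is a lower l1 estimate as soon as l - c is not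
    small. As c may be close to 1, the label 1 is given only to elements at which
    the node has used at most half of the pieces that S_xi allows it: either
    1 - c is not small and nodes with all labels 1 serve, or c is not small and a
    filler put in front of the support uses up that half, so that all labels on
    the support are 0 ([filled_member], [filled_not_at_most_half]). The
    differences x_{r i} - x_{r 0}, for a sparse set of i, and their images are thus
    l1 spreading models of order xi ([differences_l1]), against WC. *)

(** * Scalar fields with real coordinates *)

(** A field whose elements have one or two real coordinates: over the reals
    [unit2] is 0; over the complex numbers [unit2] is i, [rot] is - i, and the
    second coordinate of [z] is the real part of [- i z]. Real-valued norms keep
    the estimates away from the partial order of the complex numbers. *)
Record real_coordinates (R : realType) (K : numFieldType) := RealCoordinates {
  rpart : K -> R;
  emb : {rmorphism R -> K};
  unit2 : K;
  rot : K;
  rpartD : forall x y, rpart (x + y) = rpart x + rpart y;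
  rpartZ : forall r z, rpart (emb r * z) = r * rpart z;
  rpart1 : rpart 1 = 1;
  emb_ge0 : forall r, 0 <= r -> 0 <= emb r;
  embK : forall z, 0 <= z -> emb (rpart z) = z;
  rpart_le : forall z, `|rpart z| <= rpart `|z|;
  coordinates : forall z, z = emb (rpart z) + unit2 * emb (rpart (rot * z));
  rpart_unit2 : forall r, rpart (unit2 * emb r) = 0;
  norm_rot : `|rot| <= 1;
  norm_unit2 : `|unit2| <= 1;
  unit2_cases : unit2 = 0 \/ (rot = - unit2 /\ unit2 * unit2 = -1)
}.

Section Scalars.
Variables (R : realType) (K : numFieldType) (F : real_coordinates R K).
Local Notation re := (rpart F).
Local Notation "r %:K" := (emb F r) (at level 2, format "r %:K").
Local Notation jj := (unit2 F).
Local Notation uu := (rot F).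

Lemma re_emb r : re r%:K = r.
Proof. by rewrite -[r%:K]mulr1 rpartZ rpart1 mulr1. Qed.

Lemma re0 : re 0 = 0.
Proof. by rewrite -(rmorph0 (emb F)) re_emb. Qed.

Lemma reN x : re (- x) = - re x.
Proof. by apply/eqP; rewrite -subr_eq0 opprK -rpartD addNr re0. Qed.

Lemma re_ge0 z : 0 <= z -> 0 <= re z.
Proof.
move=> z0; have := rpart_le F z; rewrite (ger0_norm z0).
by apply: le_trans; exact: normr_ge0.
Qed.

Lemma re_le x y : x <= y -> re x <= re y.
Proof. by rewrite -subr_ge0 => /re_ge0; rewrite rpartD reN subr_ge0. Qed.

Lemma emb_le x y : (x%:K <= y%:K) = (x <= y).
Proof.
apply/idP/idP; first by move/re_le; rewrite !re_emb.
by rewrite -subr_ge0 -[in X in _ -> X]subr_ge0 -rmorphB => /(emb_ge0 F).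
Qed.

Lemma emb_lt x y : (x%:K < y%:K) = (x < y).
Proof.
rewrite !lt_def emb_le; congr (~~ _ && _).
by apply/eqP/eqP => [/(congr1 re)|->//]; rewrite !re_emb.
Qed.

Lemma real_emb r : r%:K \is Num.real.
Proof.
by rewrite realE -(rmorph0 (emb F)) !emb_le; exact: le_total.
Qed.

Lemma real_embP z : z \is Num.real -> exists r, z = r%:K.
Proof.
rewrite realE => /orP[z0|z0]; first by exists (re z); rewrite embK.
exists (- re (- z)); by rewrite rmorphN embK ?oppr_ge0// opprK.
Qed.

Definition abs (z : K) : R := re `|z|.

Lemma absE z : `|z| = (abs z)%:K.
Proof. by rewrite embK. Qed.

Lemma abs_ge0 z : 0 <= abs z. Proof. exact: re_ge0. Qed.

Lemma abs0 : abs 0 = 0. Proof. by rewrite /abs normr0 re0. Qed.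

Lemma absN z : abs (- z) = abs z. Proof. by rewrite /abs normrN. Qed.

Lemma abs1 : abs 1 = 1. Proof. by rewrite /abs normr1 rpart1. Qed.

Lemma abs_distC x y : abs (x - y) = abs (y - x).
Proof. by rewrite /abs distrC. Qed.

Lemma absM x y : abs (x * y) = abs x * abs y.
Proof. by rewrite {1}/abs normrM !absE -rmorphM re_emb. Qed.

Lemma absD x y : abs (x + y) <= abs x + abs y.
Proof. by rewrite -rpartD; apply/re_le/ler_normD. Qed.

Lemma absB x y : abs (x - y) <= abs x + abs y.
Proof. by rewrite -(absN y); exact: absD. Qed.

Lemma abs_eq0 z : abs z = 0 -> z = 0.
Proof. by move=> z0; apply/normr0_eq0; rewrite absE z0 rmorph0. Qed.

Lemma abs_gt0 z : z != 0 -> 0 < abs z.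
Proof.
move=> z0; rewrite lt_def abs_ge0 andbT; apply: contra z0 => /eqP.
by move/abs_eq0 => ->.
Qed.

Lemma abs_emb r : 0 <= r -> abs r%:K = r.
Proof. by move=> r0; rewrite /abs ger0_norm ?re_emb// emb_ge0. Qed.

Lemma re_abs z : re z <= abs z.
Proof. by apply: le_trans (rpart_le F z); exact: ler_norm. Qed.

Lemma abs_unit2 : abs jj <= 1.
Proof. by have := re_le (norm_unit2 F); rewrite rpart1. Qed.

Lemma abs_rot : abs uu <= 1.
Proof. by have := re_le (norm_rot F); rewrite rpart1. Qed.

Lemma abs_emb_le r : abs r%:K <= `|r|.
Proof.
case: (lerP 0 r) => [/abs_emb->|r0]; first exact: ler_norm.
rewrite (ltr0_norm r0); by rewrite -absN -rmorphN abs_emb// oppr_ge0 ltW.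
Qed.

Lemma abs_coordinates z : abs z <= `|re z| + `|re (uu * z)|.
Proof.
rewrite {1}(coordinates F z); apply: le_trans (absD _ _) _.
apply: lerD (abs_emb_le _) _; rewrite absM; apply: le_trans (abs_emb_le _).
by rewrite ler_piMl ?abs_ge0// abs_unit2.
Qed.

Lemma abs_sum (I : Type) (s : seq I) (P : pred I) (a : I -> K) :
  abs (\sum_(i <- s | P i) a i) <= \sum_(i <- s | P i) abs (a i).
Proof.
elim/big_ind2: _ => [|x y x' y' xy xy'|i _]; rewrite ?abs0//.
exact: le_trans (absD _ _) (lerD xy xy').
Qed.

Section RealNorm.
Variable V : normedModType K.

Definition rnorm (v : V) : R := re `|v|.

Lemma rnormE v : `|v| = (rnorm v)%:K. Proof. by rewrite embK. Qed.

Lemma rnorm_ge0 v : 0 <= rnorm v. Proof. exact: re_ge0. Qed.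

Lemma rnorm0 : rnorm 0 = 0. Proof. by rewrite /rnorm normr0 re0. Qed.

Lemma rnormN v : rnorm (- v) = rnorm v. Proof. by rewrite /rnorm normrN. Qed.

Lemma rnormZ a v : rnorm (a *: v) = abs a * rnorm v.
Proof. by rewrite {1}/rnorm normrZ absE rnormE -rmorphM re_emb. Qed.

Lemma rnormD v w : rnorm (v + w) <= rnorm v + rnorm w.
Proof. by rewrite -rpartD; apply/re_le/ler_normD. Qed.

Lemma rnormB v w : rnorm (v - w) <= rnorm v + rnorm w.
Proof. by rewrite -(rnormN w); exact: rnormD. Qed.

Lemma rnorm_distC v w : rnorm (v - w) = rnorm (w - v).
Proof. by rewrite /rnorm distrC. Qed.

Lemma rnorm_sum (I : Type) (s : seq I) (P : pred I) (f : I -> V) :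
  rnorm (\sum_(i <- s | P i) f i) <= \sum_(i <- s | P i) rnorm (f i).
Proof.
elim/big_ind2: _ => [|x y x' y' xy xy'|i _]; rewrite ?rnorm0//.
exact: le_trans (rnormD _ _) (lerD xy xy').
Qed.

(** Functionals are plain functions with an explicit bound, so that their
    pointwise limits along ultrafilters need no repackaging. *)
Definition functional (C : R) (f : V -> K) : Prop :=
  (forall a v w, f (a *: v + w) = a * f v + f w) /\
  forall v, abs (f v) <= C * rnorm v.

Section FunctionalTheory.
Variables (C : R) (f : V -> K) (fC : functional C f).

Lemma functionalD v w : f (v + w) = f v + f w.
Proof. by have := fC.1 1 v w; rewrite scale1r mul1r. Qed.

Lemma functional0 : f 0 = 0.
Proof. by apply: (addrI (f 0)); rewrite -functionalD !addr0. Qed.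

Lemma functionalZ a v : f (a *: v) = a * f v.
Proof. by have := fC.1 a v 0; rewrite functional0 !addr0. Qed.

Lemma functionalN v : f (- v) = - f v.
Proof. by rewrite -scaleN1r functionalZ mulN1r. Qed.

Lemma functionalB v w : f (v - w) = f v - f w.
Proof. by rewrite functionalD functionalN. Qed.

Lemma functional_sum (I : Type) (s : seq I) (P : pred I) (g : I -> V) :
  f (\sum_(i <- s | P i) g i) = \sum_(i <- s | P i) f (g i).
Proof. by apply: (big_morph f); [exact: functionalD|exact: functional0]. Qed.

End FunctionalTheory.
End RealNorm.

(** * The Hahn-Banach theorem *)

Lemma le_mul_inf (E : set R) (c l : R) : E !=set0 -> 0 <= l ->
  (forall x, E x -> c <= l * x) -> c <= l * inf E.
Proof.
move=> E0; rewrite le_eqVlt => /predU1P[<-|l0] cE.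
  by have [x /cE] := E0; rewrite !mul0r.
rewrite mulrC -ler_pdivrMr//; apply: lb_le_inf => // x /cE.
by rewrite ler_pdivrMr// mulrC.
Qed.

Lemma le_add_inf (E E' : set R) (c : R) : E !=set0 -> E' !=set0 ->
  (forall x y, E x -> E' y -> c <= x + y) -> c <= inf E + inf E'.
Proof.
move=> E0 E'0 cE; rewrite -lerBlDr; apply: lb_le_inf => // x Ex.
rewrite lerBlDr addrC -lerBlDr; apply: lb_le_inf => // y Ey.
by rewrite lerBlDr addrC; exact: cE.
Qed.

Section Sublinear.
Variable V : lmodType K.

Definition sublinear (p : V -> R) : Prop :=
  (forall v w, p (v + w) <= p v + p w) /\
  (forall t v, 0 <= t -> p (t%:K *: v) <= t * p v).

Lemma sublinear0 p : sublinear p -> p 0 = 0.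
Proof.
move=> [pD pZ]; have := pZ 0 0 (lexx 0); have := pD 0 0.
by rewrite scaler0 addr0 mul0r; lra.
Qed.

Lemma sublinear_opp p v : sublinear p -> - p (- v) <= p v.
Proof.
by move=> ps; have := ps.1 v (- v); rewrite subrr sublinear0//; lra.
Qed.

(** A sublinear function that is odd is linear, and the function
    [v |-> inf_t (q (v + t u) - t q u)], which is sublinear and below [q],
    is strictly below it when [q (- u)] differs from [- q u]. *)
Lemma minimal_sublinear_odd q :
  sublinear q ->
  (forall q', sublinear q' -> (forall v, q' v <= q v) ->
    forall v, q v <= q' v) ->
  forall u, q (- u) = - q u.
Proof.
move=> qs qmin u.
pose E v := [set q (v + t%:K *: u) - t * q u | t in [set t | 0 <= t]].
have E0 v : E v (q v).
  by exists 0; rewrite /= ?rmorph0 ?scale0r ?addr0 ?mul0r ?subr0.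
have En v : E v !=set0 by exists (q v).
have Elb v : has_lbound (E v).
  exists (- q (- v)) => _ [t /= t0 <-].
  have := qs.1 (v + t%:K *: u) (- v); rewrite addrAC subrr add0r.
  have := qs.2 t u t0.
  have := qs.2 t^-1 (t%:K *: u); rewrite scalerA -rmorphM invr_ge0 => /(_ t0).
  have [->|tn0] := eqVneq t 0.
    by rewrite rmorph0 scale0r !mul0r sublinear0//; lra.
  rewrite mulVf// rmorph1 scale1r -ler_pdivrMl ?invr_gt0; last first.
    by rewrite lt_def tn0.
  by rewrite invrK; lra.
have Einf v x : E v x -> inf (E v) <= x by move=> Ex; exact: ge_inf.
have := qmin (fun v => inf (E v)).
have /[swap] /[apply] : sublinear (fun v => inf (E v)).
  split=> [v w|l v l0].
    apply: le_add_inf => // _ _ [s /= s0 <-] [t /= t0 <-].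
    have /Einf/le_trans : E (v + w)
        (q (v + w + (s + t)%:K *: u) - (s + t) * q u).
      by exists (s + t) => //=; exact: addr_ge0.
    apply; have := qs.1 (v + s%:K *: u) (w + t%:K *: u).
    by rewrite rmorphD/= scalerDl addrACA; lra.
  apply: le_mul_inf => // _ [t /= t0 <-].
  have /Einf/le_trans : E (l%:K *: v)
      (q (l%:K *: v + (l * t)%:K *: u) - (l * t) * q u).
    by exists (l * t) => //=; exact: mulr_ge0.
  apply; have := qs.2 l (v + t%:K *: u) l0.
  by rewrite scalerDr scalerA -rmorphM; lra.
move=> /(_ (fun v => Einf v _ (E0 v)) (- u)).
have : E (- u) (- q u).
  exists 1 => /=; first exact: ler01.
  by rewrite rmorph1 scale1r addNr sublinear0// mul1r sub0r.
move=> /Einf; have := sublinear_opp (- u) qs; rewrite opprK.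
by move=> h1 h2 h3; apply/eqP; rewrite eq_le; apply/andP; split; lra.
Qed.

(** Zorn's lemma, downwards: the infimum of a chain of sublinear functions
    below [p] is again sublinear. *)
Lemma minimal_sublinear p : sublinear p ->
  exists q, [/\ sublinear q, forall v, q v <= p v &
    forall q', sublinear q' -> (forall v, q' v <= q v) ->
      forall v, q v <= q' v].
Proof.
move=> ps.
pose T := {q : V -> R | sublinear q /\ forall v, q v <= p v}.
pose r (q q' : T) := `[< forall v, sval q' v <= sval q v >].
pose t0 : T := exist _ p (conj ps (fun v => lexx _)).
have [|||[q [qs qp]] qmin] := @ZL_preorder T t0 r.
- by move=> q; apply/asboolP.
- move=> q1 q2 q3 /asboolP q12 /asboolP q23; apply/asboolP => v.
  exact: le_trans (q23 v) (q12 v).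
- move=> A Atot; have [[a Aa]|A0] := pselect (A !=set0); last first.
    by exists t0 => s As; exfalso; apply: A0; exists s.
  pose E v := [set sval q v | q in A].
  have En v : E v !=set0 by exists (sval a v), a.
  have Elb v : has_lbound (E v).
    exists (- p (- v)) => _ [[q [qs qp]] Aq <-] /=.
    apply: le_trans (sublinear_opp v qs); rewrite lerN2; exact: qp.
  have Einf v q : A q -> inf (E v) <= sval q v.
    by move=> Aq; apply: ge_inf => //; exists q.
  have ms : sublinear (fun v => inf (E v)).
    split=> [v w|l v l0].
      apply: le_add_inf => // _ _ [q1 Aq1 <-] [q2 Aq2 <-].
      have [/asboolP q12|/asboolP q21] := Atot _ _ Aq1 Aq2.
        apply: le_trans (Einf _ _ Aq2) _.
        by apply: le_trans ((svalP q2).1.1 v w) _; rewrite lerD2r.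
      apply: le_trans (Einf _ _ Aq1) _.
      by apply: le_trans ((svalP q1).1.1 v w) _; rewrite lerD2l.
    apply: le_mul_inf => // _ [q Aq <-].
    exact: le_trans (Einf _ _ Aq) ((svalP q).1.2 l v l0).
  have mp v : inf (E v) <= p v.
    exact: le_trans (Einf _ _ Aa) ((svalP a).2 v).
  pose m : T := exist (fun q => sublinear q /\ forall v, q v <= p v) _ (conj ms mp).
  by exists m => s As; apply/asboolP => v; exact: Einf.
exists q; split=> // q' q's q'q v.
have q'p w : q' w <= p w by exact: le_trans (q'q w) (qp w).
pose q'T : T := exist (fun q => sublinear q /\ forall v, q v <= p v) _ (conj q's q'p).
by have /asboolP := qmin q'T (introT (asboolP _) q'q); exact.
Qed.

Lemma linear_below_sublinear p : sublinear p ->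
  exists phi : V -> R, [/\ forall v w, phi (v + w) = phi v + phi w,
    forall t v, phi (t%:K *: v) = t * phi v & forall v, phi v <= p v].
Proof.
move=> /minimal_sublinear[q [qs qp /(minimal_sublinear_odd qs) qN]].
have qZ t v : 0 <= t -> q (t%:K *: v) = t * q v.
  move=> t0; apply/eqP; rewrite eq_le qs.2//=.
  have := qs.2 t (- v) t0; rewrite scalerN !qN; lra.
exists q; split=> // [v w|t v].
  apply/eqP; rewrite eq_le qs.1/=.
  by have := qs.1 (- v) (- w); rewrite -opprD !qN; lra.
case: (lerP 0 t) => [/qZ//|t0].
rewrite -[t]opprK rmorphN scaleNr qN qZ ?mulNr//.
by rewrite oppr_ge0 ltW.
Qed.

End Sublinear.

Section HahnBanach.
Variable V : normedModType K.

(** [W] is the graph of the functional to be extended. The real functional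
    produced from the infimal convolution of the norm with the graph is turned
    into a [K]-linear one by prescribing its real part. *)
Theorem hahn_banach (W : set (V * K)) (C : R) :
  0 <= C ->
  W (0, 0) ->
  (forall w t w' t', W (w, t) -> W (w', t') -> W (w + w', t + t')) ->
  (forall a w t, W (w, t) -> W (a *: w, a * t)) ->
  (forall w t, W (w, t) -> abs t <= C * rnorm w) ->
  exists2 f, functional C f & forall w t, W (w, t) -> f w = t.
Proof.
move=> C0 W0 WD WZ WC.
pose E v := [set C * rnorm (v + x.1) - re x.2 | x in W].
have En v : E v !=set0 by exists (C * rnorm v - 0), (0, 0); rewrite //= addr0 re0.
have Elb v : has_lbound (E v).
  exists (- (C * rnorm v)) => _ [[w t] Wt <-] /=.
  have := WC _ _ Wt; have := re_abs t.
  have : C * rnorm w <= C * (rnorm (v + w) + rnorm v).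
    rewrite ler_wpM2l//.
    by have := rnormB (v + w) v; rewrite addrAC subrr add0r.
  lra.
have Einf v w t : W (w, t) -> inf (E v) <= C * rnorm (v + w) - re t.
  by move=> Wt; apply: ge_inf => //; exists (w, t).
have ps : sublinear (fun v => inf (E v)).
  split=> [v v'|l v l0].
    apply: le_add_inf => // _ _ [[w t] Wt <-] [[w' t'] Wt' <-] /=.
    apply: le_trans (Einf _ _ _ (WD _ _ _ _ Wt Wt')) _.
    rewrite rpartD addrACA.
    have : C * rnorm (v + w + (v' + w')) <= C * (rnorm (v + w) + rnorm (v' + w')).
      by rewrite ler_wpM2l// rnormD.
    lra.
  apply: le_mul_inf => // _ [[w t] Wt <-] /=.
  apply: le_trans (Einf _ _ _ (WZ l%:K _ _ Wt)) _.
  by rewrite rpartZ -scalerDr rnormZ abs_emb// mulrBr mulrCA.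
have [phi [phiD phiZ phip]] := linear_below_sublinear ps.
have phi0 : phi 0 = 0.
  by have := phiZ 0 0; rewrite scaler0 mul0r.
have phiN v : phi (- v) = - phi v.
  by apply/eqP; rewrite -subr_eq0 opprK -phiD addNr phi0.
have phiC v : phi v <= C * rnorm v.
  by apply: le_trans (phip v) _; have := Einf v _ _ W0; rewrite addr0 re0 subr0.
have phiW w t : W (w, t) -> phi w = re t.
  have W_le w' t' : W (w', t') -> re t' <= phi w'.
    move=> Wt; have := phip (- w'); have := Einf (- w') _ _ Wt.
    by rewrite addNr rnorm0 mulr0 phiN; lra.
  move=> Wt; apply/eqP; rewrite eq_le W_le// andbT.
  have := W_le _ _ (WZ (-1) _ _ Wt).
  by rewrite scaleN1r mulN1r reN phiN; lra.
pose f v := (phi v)%:K + jj * (phi (uu *: v))%:K.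
have fD v w : f (v + w) = f v + f w.
  by rewrite /f scalerDr !phiD !rmorphD/=; ring.
have fZ z v : f (z *: v) = z * f v.
  rewrite (coordinates F z).
  move: (re z) (re (uu * z)) => a b {z}.
  rewrite scalerDl fD mulrDl.
  have fr r w : f (r%:K *: w) = r%:K * f w.
    by rewrite /f phiZ scalerA [uu * _]mulrC -scalerA phiZ !rmorphM/=; ring.
  have -> : (jj * b%:K) *: v = b%:K *: (jj *: v) by rewrite scalerA mulrC.
  rewrite !fr; congr (_ + _); rewrite [jj * _]mulrC -mulrA; congr (_ * _).
  rewrite /f; have [->|[-> jj2]] := unit2_cases F.
    by rewrite scale0r phi0 rmorph0 !mul0r addr0.
  rewrite scalerA mulNr jj2 opprK scale1r scaleNr phiN rmorphN/=.
  rewrite mulrDr !mulrN mulrA jj2; ring.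
have ref v : re (f v) = phi v by rewrite rpartD rpart_unit2 addr0 re_emb.
exists f; last first.
  move=> w t Wt.
  by rewrite /f (phiW _ _ Wt) (phiW _ _ (WZ uu _ _ Wt)) -coordinates.
split=> [a v w|v]; first by rewrite fD fZ.
have [->|fv0] := eqVneq (f v) 0.
  by rewrite abs0 mulr_ge0// rnorm_ge0.
pose th := (abs (f v))%:K / f v.
have thv : f (th *: v) = (abs (f v))%:K by rewrite fZ mulfVK.
have := ref (th *: v); rewrite thv re_emb => ->.
apply: le_trans (phiC _) _; rewrite rnormZ.
suff -> : abs th = 1 by rewrite mul1r.
apply: (@mulIf _ (abs (f v))); first by rewrite gt_eqF// abs_gt0.
by rewrite -absM mulfVK// abs_emb ?abs_ge0// mul1r.
Qed.

Lemma norming_functional (v : V) : exists2 f, functional 1 f & f v = (rnorm v)%:K.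
Proof.
have [|||||f f1 fW] :=
  @hahn_banach [set x | exists a, x = (a *: v, a * (rnorm v)%:K)] 1.
- exact: ler01.
- by exists 0; rewrite scale0r mul0r.
- move=> _ _ _ _ [a [-> ->]] [b [-> ->]]; exists (a + b).
  by rewrite scalerDl mulrDl.
- by move=> b _ _ [a [-> ->]]; exists (b * a); rewrite scalerA mulrA.
- move=> _ _ [a [-> ->]].
  by rewrite absM rnormZ abs_emb ?rnorm_ge0// mul1r.
exists f => //; apply: fW; exists 1; by rewrite scale1r mul1r.
Qed.

(** Helly's criterion for a finite system of equations. *)
Lemma helly_extension (I : eqType) (s : seq I) (v : I -> V) (t : I -> K) (C : R) :
  uniq s -> 0 <= C ->
  (forall a : I -> K, abs (\sum_(i <- s) a i * t i) <=
     C * rnorm (\sum_(i <- s) a i *: v i)) ->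
  exists2 f, functional C f & forall i, i \in s -> f (v i) = t i.
Proof.
move=> us C0 stC.
have [||||f fC fW] := @hahn_banach [set x | exists a : I -> K,
  x = (\sum_(i <- s) a i *: v i, \sum_(i <- s) a i * t i)] C C0.
- by exists (fun=> 0); rewrite !big1// => i _; rewrite ?scale0r ?mul0r.
- move=> _ _ _ _ [a [-> ->]] [b [-> ->]]; exists (fun i => a i + b i).
  rewrite -!big_split/=; congr (_, _); apply: eq_bigr => i _.
    by rewrite scalerDl.
  by rewrite mulrDl.
- move=> b _ _ [a [-> ->]]; exists (fun i => b * a i).
  rewrite scaler_sumr mulr_sumr.
  by congr (_, _); apply: eq_bigr => i _; rewrite ?scalerA ?mulrA.
- by move=> _ _ [a [-> ->]]; exact: stC.
exists f => // i si; apply: fW; exists (fun j => (j == i)%:R).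
rewrite !(bigD1_seq i)//= eqxx scale1r mul1r.
by rewrite !big1 ?addr0// => j /negPf ->; rewrite ?mul0r ?scale0r.
Qed.

End HahnBanach.
End Scalars.

(** * Combinatorics of the Schreier families *)

Section FiniteSets.
Implicit Types E A B : {fset nat}.

Lemma fset_min_in E : E != fset0 -> fset_min E \in E.
Proof.
move=> E0; rewrite /fset_min -(mem_sort leq).
case: (sort leq E) (mem_sort leq E) => [|m s _]; last by rewrite inE eqxx.
by move=> sE; case/fset0Pn: E0 => x; rewrite -sE.
Qed.

Lemma fset_min_le E i : i \in E -> (fset_min E <= i)%N.
Proof.
rewrite /fset_min -(mem_sort leq).
have := sort_sorted leq_total E.
case: (sort leq E) => [//|m s] /= ms; rewrite inE => /predU1P[->//|si].
by have /allP := order_path_min leq_trans ms; exact.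
Qed.

Lemma fset_min_unique E m :
  m \in E -> (forall i, i \in E -> (m <= i)%N) -> fset_min E = m.
Proof.
move=> mE mle; apply/eqP; rewrite eqn_leq fset_min_le//= mle// fset_min_in//.
by apply/fset0Pn; exists m.
Qed.

Lemma fset_min_sub A E : A != fset0 -> (A `<=` E)%fset ->
  (fset_min E <= fset_min A)%N.
Proof. by move=> A0 /fsubsetP AE; apply/fset_min_le/AE/fset_min_in. Qed.

Lemma fset_lt_sub A B A' B' : (A' `<=` A)%fset -> (B' `<=` B)%fset ->
  fset_lt A B -> fset_lt A' B'.
Proof. by move=> /fsubsetP sA /fsubsetP sB AB i j /sA iA /sB; exact: AB. Qed.

Lemma mem_image (f : nat -> nat) E i : i \in E -> f i \in [fset f j | j in E]%fset.
Proof. by move=> iE; apply/imfsetP; exists i. Qed.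

End FiniteSets.

Definition increasing_on (E : {fset nat}) (f : nat -> nat) : Prop :=
  forall i j, i \in E -> j \in E -> (i < j)%N -> (f i < f j)%N.

Definition initial (L : nat -> nat) (k : nat) : {fset nat} :=
  [fset x in mkseq L k]%fset.

Lemma initialP L k x : reflect (exists2 i, (i < k)%N & x = L i) (x \in initial L k).
Proof.
rewrite inE; apply: (iffP mapP) => [[j]|[j jk ->]].
  by rewrite mem_iota/= => jk ->; exists j.
by exists j; rewrite ?mem_iota.
Qed.

(** The properties that pass from one level of the hierarchy to the next. The
    last one is compactness: under end-extension the members form a well founded
    tree. *)
Record regular (G : set {fset nat}) : Prop := Regular {
  regular0 : G fset0;
  hereditary : forall E F, (F `<=` E)%fset -> G E -> G F;
  spreading : forall E f, increasing_on E f -> (forall i, i \in E -> (i <= f i)%N) ->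
    G E -> G [fset f i | i in E]%fset;
  positive : forall E, G E -> 0%N \notin E;
  singletons : forall n, (0 < n)%N -> G [fset n]%fset;
  no_infinite_branch : forall L, {homo L : i j / (i < j)%N} ->
    exists k, ~ G (initial L k)
}.

(** A recursive form of the convolution with the Schreier family, which can be
    split and concatenated by induction. Empty pieces only waste room. *)
Fixpoint pieces (n : nat) (G : set {fset nat}) : set {fset nat} :=
  match n with
  | 0 => [set fset0]
  | n.+1 => [set E | exists A B,
      [/\ G A, pieces n G B, fset_lt A B & E = (A `|` B)%fset]]
  end.

Lemma bigcup_ord n (Es : 'I_n -> {fset nat}) :
  (\bigcup_(i in 'I_n) Es i = \big[@fsetU nat/fset0]_(i < n) Es i)%fset.
Proof. exact: eq_bigl. Qed.

Section Pieces.
Variables (G : set {fset nat}) (rG : regular G).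
Implicit Types E A B : {fset nat}.

Lemma pieces0 n : pieces n G fset0.
Proof.
elim: n => //= n IH; exists fset0, fset0; split=> //; first exact: regular0.
by rewrite fsetU0.
Qed.

Lemma pieces_cat a b A B : pieces a G A -> pieces b G B -> fset_lt A B ->
  pieces (a + b) G (A `|` B)%fset.
Proof.
elim: a A => [|a IH] A /=; first by move=> -> pB _; rewrite fset0U.
move=> [A1 [A2 [GA1 pA2 A12 ->]]] pB AB; exists A1, (A2 `|` B)%fset; split=> //.
- apply: IH => //; apply: fset_lt_sub AB => //; exact: fsubsetUr.
- move=> i j iA1; rewrite inE => /orP[|jB]; first exact: A12.
  by apply: AB => //; rewrite inE iA1.
- by rewrite fsetUA.
Qed.

Lemma pieces_leq n m E : (n <= m)%N -> pieces n G E -> pieces m G E.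
Proof.
move=> /subnKC <- nE; rewrite -[E]fsetU0.
by apply: pieces_cat => //; exact: pieces0.
Qed.

Lemma pieces1 A : G A -> pieces 1 G A.
Proof. by move=> GA; exists A, fset0; split=> //; rewrite fsetU0. Qed.

Lemma pieces_hereditary n E F : (F `<=` E)%fset -> pieces n G E -> pieces n G F.
Proof.
elim: n E F => [|n IH] E F /= FE; first by move=> E0; apply/eqP; rewrite -fsubset0 -E0.
move=> [A [B [GA pB AB EAB]]]; exists (F `&` A)%fset, (F `&` B)%fset; split.
- by apply: hereditary GA => //; exact: fsubsetIr.
- by apply: IH pB; exact: fsubsetIr.
- by apply: fset_lt_sub AB; exact: fsubsetIr.
- by rewrite -fsetIUr -EAB; apply/esym/fsetIidPl.
Qed.

Lemma pieces_spreading n E f : increasing_on E f ->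
  (forall i, i \in E -> (i <= f i)%N) ->
  pieces n G E -> pieces n G [fset f i | i in E]%fset.
Proof.
elim: n E => [|n IH] E /= fi fE; first by move=> ->; rewrite imfset0.
move=> [A [B [GA pB AB EAB]]].
have AE i : i \in A -> i \in E by rewrite EAB inE => ->.
have BE i : i \in B -> i \in E by rewrite EAB inE orbC => ->.
exists [fset f i | i in A]%fset, [fset f i | i in B]%fset; split.
- by apply: spreading => // [i j /AE iE /AE|i /AE]; [exact: fi|exact: fE].
- by apply: IH => // [i j /BE iE /BE|i /BE]; [exact: fi|exact: fE].
- by move=> _ _ /imfsetP[i /= iA ->] /imfsetP[j /= jB ->]; apply: fi; auto.
- by rewrite EAB imfsetU.
Qed.

Lemma pieces_positive n E : pieces n G E -> 0%N \notin E.
Proof.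
elim: n E => [|n IH] E /=; first by move=> ->; rewrite inE.
move=> [A [B [/(positive rG)A0 /IH B0 _ ->]]]; by rewrite inE negb_or A0.
Qed.

(** Along an infinite branch the first piece stops before some stage that
    depends only on [G], and the rest of the branch is covered by one piece
    fewer. *)
Lemma pieces_no_infinite_branch n L : {homo L : i j / (i < j)%N} ->
  exists k, ~ pieces n G (initial L k).
Proof.
elim: n L => [|n IH] L Lmono.
  exists 1%N => /= /fsetP/(_ (L 0%N)); rewrite [RHS]inE => /negP/negP/negP; apply.
  by apply/initialP; exists 0%N.
have [k0 k0G] := no_infinite_branch rG Lmono.
have [|k1 k1G] := IH (fun i => L (k0 + i)%N).
  by move=> i j ij; apply: Lmono; rewrite ltn_add2l.
exists (k0 + k1)%N => /= -[A [B [GA pB AB EAB]]].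
have mE i : (i < k0 + k1)%N -> (L i \in A) || (L i \in B).
  by move=> ik; rewrite -in_fsetU -EAB; apply/initialP; exists i.
have [i ik0 iA] : exists2 i, (i < k0)%N & L i \notin A.
  apply: contrapT => nA; apply: k0G; apply: hereditary GA => //.
  apply/fsubsetP => _ /initialP[i ik0 ->]; apply: contrapT => /negP iA.
  by apply: nA; exists i.
apply: k1G; apply: pieces_hereditary pB; apply/fsubsetP => _ /initialP[j jk ->].
have iB : L i \in B by have := mE _ (ltn_addr k1 ik0); rewrite (negPf iA).
have := mE (k0 + j)%N; rewrite ltn_add2l => /(_ jk)/orP[jA|//].
have := AB _ _ jA iB; have := Lmono i (k0 + j)%N (ltn_addr _ ik0); lia.
Qed.

Lemma pieces_bigcup n (Es : 'I_n -> {fset nat}) :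
  (forall i, G (Es i)) -> (forall i j : 'I_n, (i < j)%N -> fset_lt (Es i) (Es j)) ->
  pieces n G (\bigcup_(i in 'I_n) Es i)%fset.
Proof.
elim: n Es => [|n IH] Es GE Ei; first by rewrite big_ord0.
exists (Es ord0), (\bigcup_(i in 'I_n) Es (lift ord0 i))%fset; split=> //.
- apply: IH => // i j ij; apply: Ei; by rewrite !lift0 ltnS.
- by move=> x y xE /bigfcupP[i _]; apply: Ei xE; rewrite lift0.
- by rewrite !bigcup_ord big_ord_recl.
Qed.

Lemma pieces_nonempty n E : pieces n G E ->
  exists m (Es : 'I_m -> {fset nat}), [/\ (m <= n)%N,
    forall i, Es i != fset0 /\ G (Es i),
    forall i j : 'I_m, (i < j)%N -> fset_lt (Es i) (Es j)
    & E = (\bigcup_(i in 'I_m) Es i)%fset].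
Proof.
elim: n E => [|n IH] E /=.
  move=> ->; exists 0%N, (fun=> fset0); split=> //; try by case.
  by rewrite big_ord0.
move=> [A [B [GA /IH[m [Es [mn Es0 Ei EB]]] AB ->]]].
have [->|A0] := eqVneq A fset0.
  by exists m, Es; rewrite fset0U; split=> //; exact: leqW.
exists m.+1, (fun i => oapp Es A (unlift ord0 i)); split=> //.
- by move=> i; case: unliftP => [j|] _ /=.
- move=> i j; case: unliftP => [i'|] ->; case: unliftP => [j'|] -> //=.
    rewrite /bump !add1n ltnS; exact: Ei.
  move=> _ x y xA yE; apply: AB => //; rewrite EB.
  by apply/bigfcupP; exists j' => //; rewrite mem_index_enum.
- rewrite bigcup_ord big_ord_recl unlift_none/= EB bigcup_ord.
  by congr fsetU; apply: eq_bigr => i _; rewrite liftK.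
Qed.

(** The number of nonempty pieces is the cardinality of the set of their minima,
    and the least of these is the minimum of the union. *)
Lemma convolution_schreierE E :
  convolution schreier G E <-> E = fset0 \/ pieces (fset_min E) G E.
Proof.
split.
  move=> [n [Es [EsG Ei sM EE]]].
  have [->|E0] := eqVneq E fset0; [by left|right].
  apply: (@pieces_leq n); last first.
    by rewrite EE; apply: pieces_bigcup => // i; case: (EsG i).
  have /bigfcupP[i0 _ mEi0] : fset_min E \in (\bigcup_(i in 'I_n) Es i)%fset.
    by rewrite -EE; exact: fset_min_in.
  set M := [fset _ | _ : _]%fset in sM.
  have iM i : fset_min (Es i) \in M by apply/imfsetP; exists i.
  have cM : #|` M| = n.
    rewrite card_imfset/=; first by rewrite size_enum_ord.
    move=> i j ij; apply: val_inj => /=.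
    have mi := fset_min_in (EsG i).1; have mj := fset_min_in (EsG j).1.
    case: (ltngtP i j) => // ltij.
      by have := Ei _ _ ltij _ _ mi mj; rewrite ij ltnn.
    by have := Ei _ _ ltij _ _ mj mi; rewrite ij ltnn.
  case: sM => [M0|]; first by have := iM i0; rewrite M0 inE.
  rewrite cM => /leq_trans; apply; apply: (leq_trans (fset_min_le (iM i0))).
  exact: fset_min_le.
case=> [->|pE].
  exists 0%N, (fun=> fset0); split; try by case.
    by left; apply/fsetP => x; rewrite [RHS]inE; apply/negP => /imfsetP[[]].
  by rewrite big_ord0.
have [m [Es [mn EsG Ei EE]]] := pieces_nonempty pE.
exists m, Es; split=> //; set M := [fset _ | _ : _]%fset.
have [M0|M0] := eqVneq M fset0; [by left|right].
have cM : (#|` M| <= m)%N.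
  by apply: leq_trans (leq_imfset_card _ _ _) _; rewrite /= -cardE card_ord.
apply: leq_trans cM (leq_trans mn _).
have /imfsetP[i _ ->] := fset_min_in M0.
apply: fset_min_le; rewrite EE; apply/bigfcupP; exists i.
  by rewrite mem_index_enum.
by apply: fset_min_in; case: (EsG i).
Qed.

End Pieces.

(** The stability that lets differences of two terms replace the terms of a
    sequence. *)
Definition doubling (G : set {fset nat}) : Prop :=
  forall E (p q : nat -> nat), (forall k, (k.*2 <= p k)%N) ->
    (forall k, (p k < q k)%N) -> (forall k, (q k < p k.+1)%N) ->
    G E -> G ([fset p k | k in E] `|` [fset q k | k in E])%fset.

(** A common description of the successor levels, where [Gs] is constant, and of
    the limit levels, where [Gs r] is the predecessor of the [r]-th term of the
    fundamental sequence. As the pieces may be taken in any later [Gs r], members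
    with different minima can be joined. *)
Definition layered (G : set {fset nat}) (Gs : nat -> set {fset nat}) : Prop :=
  [/\ forall r, regular (Gs r),
    forall E r, G E -> E != fset0 -> (fset_min E <= r)%N ->
      pieces (fset_min E) (Gs r) E
    & forall E, E != fset0 -> pieces (fset_min E) (Gs (fset_min E)) E -> G E].

Section Interlaced.
Variables (p q : nat -> nat).
Hypotheses (p2 : forall k, (k.*2 <= p k)%N) (pq : forall k, (p k < q k)%N).
Hypothesis qp : forall k, (q k < p k.+1)%N.
Let D (E : {fset nat}) := ([fset p k | k in E] `|` [fset q k | k in E])%fset.

Lemma interlacedU A B : D (A `|` B)%fset = (D A `|` D B)%fset.
Proof. by rewrite /D !imfsetU fsetUACA. Qed.

Lemma interlaced_lt_step i j : (i < j)%N -> (q i < p j)%N.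
Proof.
elim: j => // j IH; rewrite ltnS leq_eqVlt => /predU1P[->//|/IH].
by move=> /ltn_trans; apply; exact: ltn_trans (pq j) (qp j).
Qed.

Lemma interlaced_lt A B : fset_lt A B -> fset_lt (D A) (D B).
Proof.
move=> AB x y; rewrite !inE.
have key i j : i \in A -> j \in B -> (q i < p j)%N.
  by move=> iA jB; exact/interlaced_lt_step/AB.
move=> /orP[] /imfsetP[i /= iA ->] /orP[] /imfsetP[j /= jB ->];
  have := key _ _ iA jB; have := pq i; have := pq j; lia.
Qed.

Lemma interlaced_neq0 E : E != fset0 -> D E != fset0.
Proof.
by case/fset0Pn => x xE; apply/fset0Pn; exists (p x); rewrite inE mem_image.
Qed.

Lemma interlaced_min E : E != fset0 -> ((fset_min E).*2 <= fset_min (D E))%N.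
Proof.
move=> E0; have := fset_min_in (interlaced_neq0 E0); rewrite inE.
case/orP=> /imfsetP[i /= /fset_min_le iE ->]; rewrite -leq_double in iE.
  exact: leq_trans iE (p2 i).
exact/(leq_trans iE)/(leq_trans (p2 i))/ltnW.
Qed.

End Interlaced.

Lemma schreier0_regular : regular schreier0.
Proof.
split.
- by left.
- move=> E F FE [E0|[n n0 En]]; first by left; apply/eqP; rewrite -fsubset0 -E0.
  by move: FE; rewrite En fsubset1 => /orP[]/eqP ->; [right; exists n|left].
- move=> E f _ fE [->|[n n0 En]]; first by left; rewrite imfset0.
  right; exists (f n); last by rewrite En imfset_fset1.
  by apply: leq_trans (fE n _); rewrite // En inE.
- by move=> E [->|[n n0 ->]]; rewrite !inE// eq_sym -lt0n.
- by move=> n n0; right; exists n.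
- move=> L Lmono; exists 2%N.
  have m0 : L 0%N \in initial L 2 by apply/initialP; exists 0%N.
  have m1 : L 1%N \in initial L 2 by apply/initialP; exists 1%N.
  have := Lmono 0%N 1%N isT => L01 [E0|[n _ En]].
    by move: m0; rewrite E0 inE.
  by move: m0 m1 L01; rewrite En !inE => /eqP-> /eqP->; rewrite ltnn.
Qed.

Section Convolution.
Variables (G : set {fset nat}) (rG : regular G).

Lemma convolution_layered : layered (convolution schreier G) (fun=> G).
Proof.
split=> // [E r|E E0 pE]; last by apply/convolution_schreierE => //; right.
by move=> /(convolution_schreierE rG)[->|]//; rewrite eqxx.
Qed.

Lemma convolution_regular : regular (convolution schreier G).
Proof.
have cE := convolution_schreierE rG.
split.
- by apply/cE; left.
- move=> E F FE /cE GE; apply/cE.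
  have [->|F0] := eqVneq F fset0; [by left|right].
  case: GE => [E0|pE].
    by move: FE F0; rewrite E0 fsubset0 => ->.
  apply: (pieces_leq rG (fset_min_sub F0 FE)).
  exact: (pieces_hereditary rG FE pE).
- move=> E f fi fE /cE GE; apply/cE.
  case: GE => [->|pE]; first by left; rewrite imfset0.
  have [->|E0] := eqVneq E fset0; first by left; rewrite imfset0.
  right; apply: (pieces_leq rG _ (pieces_spreading rG fi fE pE)).
  have fE0 : [fset f i | i in E]%fset != fset0.
    by apply/fset0Pn; exists (f (fset_min E)); apply/mem_image/fset_min_in.
  have /imfsetP[i /= iE ->] := fset_min_in fE0.
  exact: leq_trans (fset_min_le iE) (fE _ iE).
- by move=> E /cE[->|/(pieces_positive rG)//]; rewrite inE.
- move=> n n0; apply/cE; right; apply: (@pieces_leq _ rG 1).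
    by rewrite (@fset_min_unique _ n)// ?inE// => i; rewrite inE => /eqP->.
  exact: (pieces1 (singletons rG n0)).
- move=> L Lmono; have [k kL] := pieces_no_infinite_branch rG (L 0%N) Lmono.
  exists k => /cE; case: k kL => [|k] kL.
    have -> : initial L 0 = fset0 by apply/fsetP => x; rewrite !inE.
    move=> _; apply: kL.
    have -> : initial L 0 = fset0 by apply/fsetP => x; rewrite !inE.
    exact: (pieces0 rG).
  have m0 : L 0%N \in initial L k.+1 by apply/initialP; exists 0%N.
  case=> [E0|]; first by move: m0; rewrite E0 inE.
  rewrite (@fset_min_unique _ (L 0%N))// => _ /initialP[[|i] _ ->]//.
  exact/ltnW/Lmono.
Qed.

Lemma convolution_doubling : doubling G -> doubling (convolution schreier G).
Proof.
move=> dG E p q p2 pq qp /(convolution_schreierE rG)[->|pE].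
  by rewrite !imfset0 fsetU0; exact: regular0 convolution_regular.
apply/(convolution_schreierE rG).
have [->|E0] := eqVneq E fset0; first by left; rewrite !imfset0 fsetU0.
right; apply: (@pieces_leq _ rG (fset_min E)).
  by apply: leq_trans (interlaced_min p2 pq E0); rewrite -addnn leq_addr.
move: (fset_min E) pE => m {E0}; elim: m E => [|n IH] E /=.
  by move=> ->; rewrite !imfset0 fsetU0.
move=> [A [B [GA pB AB ->]]]; rewrite interlacedU.
do 2 eexists; split; [exact: (dG A p q p2 pq qp GA)|exact: IH pB| |by []].
exact: interlaced_lt.
Qed.

End Convolution.

(** A pair is not a member of [schreier0], so the number of pieces doubles; so does
    the minimum, which is the number of pieces allowed. *)
Lemma schreier1_doubling : doubling (convolution schreier schreier0).
Proof.
have rG := schreier0_regular.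
move=> E p q p2 pq qp /(convolution_schreierE rG)[->|pE].
  by rewrite !imfset0 fsetU0; exact: regular0 (convolution_regular rG).
apply/(convolution_schreierE rG).
have [->|E0] := eqVneq E fset0; first by left; rewrite !imfset0 fsetU0.
right; apply: (@pieces_leq _ rG (fset_min E).*2); first exact: interlaced_min.
move: (fset_min E) pE => m {E0}; elim: m E => [|n IH] E.
  by move=> ->; rewrite !imfset0 fsetU0.
move=> [A [B [GA pB AB ->]]]; rewrite interlacedU doubleS -addn2 addnC.
apply: pieces_cat; [|exact: IH|exact: interlaced_lt].
case: GA => [->|[k k0 ->]]; first by rewrite !imfset0 fsetU0; exact: (pieces0 rG).
rewrite !imfset_fset1 -[2%N]/(1 + 1)%N; apply: pieces_cat.
- by apply/pieces1/(singletons rG) => //; have := p2 k; lia.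
- by apply/pieces1/(singletons rG) => //; have := pq k; lia.
- by move=> x y; rewrite !inE => /eqP-> /eqP->.
Qed.

Section Hierarchy.
Variables (d : Order.disp_t) (T : orderType d) (T_ordinals : countable_ordinals T).
Variables (fs : T -> nat -> T) (S : T -> set {fset nat}).
Hypothesis S_schreier : schreier_hierarchy fs S.

Lemma ordinal_ind (P : T -> Prop) :
  (forall x, (forall y, (y < x)%O -> P y) -> P x) -> forall x, P x.
Proof.
move=> IH x; apply: contrapT => nPx.
have [|y [[/asboolP yP ymin] _]] := T_ordinals.1 (fun y => `[< ~ P y >]).
  by exists x; apply/asboolP.
apply: yP; apply: IH => z zy; apply: contrapT => nPz.
have := ymin z; rewrite inE => /(_ nPz).
by rewrite leNgt zy.
Qed.

Let nice x := regular (S x) /\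
  (~ is_zero x -> doubling (S x) /\ exists Gs, layered (S x) Gs).

Lemma succ_not_zero (x y : T) : is_succ x y -> ~ is_zero y.
Proof. by move=> [xy _] /(_ x); rewrite leNgt xy. Qed.

Lemma schreier_nice_succ x y : is_succ x y -> nice x -> nice y.
Proof.
have [S0 S1 _] := S_schreier.
move=> xy [rx dx]; rewrite /nice (S1 _ _ xy); split.
  exact: convolution_regular.
move=> _; split; last by exists (fun=> S x); exact: convolution_layered.
have [x0|x0] := pselect (is_zero x).
  by rewrite (S0 _ x0); exact: schreier1_doubling.
by apply: convolution_doubling => //; case: (dx x0).
Qed.

(** The families along the fundamental sequence increase, so for a set with
    minimum [r] only the [r]-th of them matters. *)
Lemma schreier_nice_limit x : is_limit x ->
  (forall y, (y < x)%O -> nice y) -> nice x.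
Proof.
have [_ S1 Slim] := S_schreier.
move=> xlim IH; have [fsx _ Sx] := Slim _ xlim.
have fs_nice n : (0 < n)%N -> nice (fs x n).
  by move=> n0; have [_ + _ _] := fsx _ n0; exact: IH.
have fs_reg n n0 := (fs_nice n n0).1.
have fs_dbl n (n0 : (0 < n)%N) : doubling (S (fs x n)).
  have [[y ysucc] _ _ _] := fsx _ n0.
  by case: ((fs_nice n n0).2 (succ_not_zero ysucc)).
have fs_mono n m E : (0 < n)%N -> (n <= m)%N -> S (fs x n) E -> S (fs x m) E.
  move=> n0 /subnKC <-; elim: (m - n)%N => [|k IHk]; first by rewrite addn0.
  move=> /IHk; rewrite addnS; have [|_ _ _] := fsx (n + k)%N; last exact.
  by rewrite addn_gt0 n0.
have SxE E : S x E <-> E = fset0 \/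
    [/\ E != fset0, (0 < fset_min E)%N & S (fs x (fset_min E)) E].
  rewrite Sx; split=> /= -[->|]; try by left.
    have [->|E0 [n [n0 nE SE]]] := eqVneq E fset0; [by left|right].
    by split=> //; [exact: leq_trans nE|exact: fs_mono SE].
  by move=> [E0 mE SE]; right; exists (fset_min E).
split.
  split.
  - by apply/SxE; left.
  - move=> E F FE /SxE SE; apply/SxE.
    have [->|F0] := eqVneq F fset0; [by left|right].
    case: SE => [E0|[E0 mE SE]]; first by move: FE F0; rewrite E0 fsubset0 => ->.
    have EF := fset_min_sub F0 FE; split=> //; first exact: leq_trans EF.
    by apply: (hereditary (fs_reg _ _) FE (fs_mono _ _ _ _ EF SE)) => //;
      exact: leq_trans EF.
  - move=> E f fi fE /SxE[->|[E0 mE SE]]; first by rewrite imfset0; apply/SxE; left.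
    have fE0 : [fset f i | i in E]%fset != fset0.
      by apply/fset0Pn; exists (f (fset_min E)); apply/mem_image/fset_min_in.
    have fm : (fset_min E <= fset_min [fset f i | i in E]%fset)%N.
      have /imfsetP[i /= iE ->] := fset_min_in fE0.
      exact: leq_trans (fset_min_le iE) (fE _ iE).
    have fm0 := leq_trans mE fm.
    apply/SxE; right; split=> //.
    exact: (spreading (fs_reg _ fm0) fi fE (fs_mono _ _ _ mE fm SE)).
  - move=> E /SxE[->|[_ mE SE]]; first by rewrite inE.
    exact: positive (fs_reg _ mE) _ SE.
  - move=> n n0; apply/SxE; right.
    have mn : fset_min [fset n]%fset = n.
      by rewrite (@fset_min_unique _ n)// ?inE// => i; rewrite inE => /eqP->.
    rewrite mn; split=> //; last exact: singletons (fs_reg _ n0) _ n0.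
    by apply/fset0Pn; exists n; rewrite inE.
  - move=> L Lmono.
    have [k kL] := no_infinite_branch (fs_reg (L 0%N).+1 isT) Lmono.
    exists k => /SxE SL; apply: kL.
    case: SL => [->|[L0 mL SL]]; first exact: regular0 (fs_reg _ _).
    have /fset0Pn[_ /initialP[i ik _]] := L0.
    have mL0 : fset_min (initial L k) = L 0%N.
      apply: fset_min_unique; first by apply/initialP; exists 0%N => //; case: k ik {L0 mL SL}.
      by move=> _ /initialP[[|j] _ ->]//; exact/ltnW/Lmono.
    by move: mL SL; rewrite mL0 => mL; apply: fs_mono.
move=> _; split.
  move=> E p q p2 pq qp /SxE[->|[E0 mE SE]].
    by rewrite !imfset0 fsetU0; apply/SxE; left.
  have D0 := interlaced_neq0 p q E0; have Dm := interlaced_min p2 pq E0.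
  have mD : (fset_min E <= fset_min ([fset p k | k in E] `|` [fset q k | k in E])%fset)%N.
    by apply: leq_trans Dm; rewrite -addnn leq_addr.
  apply/SxE; right; split=> //; first exact: leq_trans mD.
  exact/(fs_mono _ _ _ mE mD)/(fs_dbl _ mE).
have /choice[pr prP] r : exists y, is_succ y (fs x (maxn r 1)).
  by have [] := fsx (maxn r 1) (leq_maxr r 1).
have pr_reg r : regular (S (pr r)).
  have [+ _ _ _] := fsx (maxn r 1) (leq_maxr r 1); move=> _.
  apply: (IH _ _).1; apply: (lt_trans (prP r).1).
  by have [] := fsx (maxn r 1) (leq_maxr r 1).
exists (fun r => S (pr r)); split=> //.
  move=> E r /SxE[->|[E0 mE SE _ Er]]; first by rewrite eqxx.
  have r0 := leq_trans mE Er.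
  have := fs_mono _ _ _ mE Er SE.
  have := prP r; rewrite (maxn_idPl r0) => /S1 ->.
  move=> /(convolution_schreierE (pr_reg r))[E0'|//].
  by rewrite E0' eqxx in E0.
move=> E E0 pE; apply/SxE; right.
have mE : (0 < fset_min E)%N.
  rewrite lt0n; apply: contra E0 => /eqP m0; move: pE; by rewrite m0 /= => ->.
split=> //.
have := prP (fset_min E); rewrite (maxn_idPl mE) => /S1 ->.
by apply/convolution_schreierE => //; right.
Qed.

Theorem schreier_nice x : nice x.
Proof.
elim/ordinal_ind: x => x IH.
have [x0|x0] := pselect (is_zero x).
  split=> [|/(_ x0)[]]; have [-> // _ _] := S_schreier; exact: schreier0_regular.
have [[y yx]|xs] := pselect (exists y, is_succ y x).
  by apply: (schreier_nice_succ yx); apply: IH; case: yx.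
exact: schreier_nice_limit.
Qed.

End Hierarchy.

(** * Limits along ultrafilters *)

Section UltraLimits.
Variables (R : realType) (K : numFieldType) (F : real_coordinates R K).
Local Notation re := (rpart F).
Local Notation "r %:K" := (emb F r) (at level 2, format "r %:K").
Local Notation abs := (abs F).
Local Notation N := (rnorm F).

Section Limits.
Variable X : Type.
Implicit Types (V : set_system X) (g h : X -> K).

Definition tends V g (l : K) : Prop :=
  forall e : R, 0 < e -> V [set x | abs (g x - l) < e].

Lemma tends_near V {FV : Filter V} g h l : V [set x | g x = h x] ->
  tends V g l -> tends V h l.
Proof.
move=> gh gl e e0; apply: filterS (filterI gh (gl e e0)).
by move=> x /= [-> //].
Qed.

Lemma tends_cst V {FV : Filter V} l : tends V (fun=> l) l.
Proof.
move=> e e0; apply: filterS filterT => x _ /=.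
by rewrite subrr abs0.
Qed.

Lemma tendsD V {FV : Filter V} g h a b : tends V g a -> tends V h b ->
  tends V (fun x => g x + h x) (a + b).
Proof.
move=> ga hb e e0; have e20 : 0 < e / 2 by rewrite divr_gt0.
apply: filterS (filterI (ga _ e20) (hb _ e20)) => x [/= gx hx].
rewrite opprD addrACA; apply: le_lt_trans (absD _ _ _) _; lra.
Qed.

Lemma tendsZ V {FV : Filter V} g a b : tends V g b ->
  tends V (fun x => a * g x) (a * b).
Proof.
move=> gb e e0; have [->|a0] := eqVneq a 0.
  by apply: filterS filterT => x _ /=; rewrite !mul0r subrr abs0.
have aa := abs_gt0 F a0.
apply: filterS (gb (e / abs a) (divr_gt0 e0 aa)) => x /= gx.
by rewrite -mulrBr absM mulrC -ltr_pdivlMr.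
Qed.

Lemma tendsB V {FV : Filter V} g h a b : tends V g a -> tends V h b ->
  tends V (fun x => g x - h x) (a - b).
Proof.
move=> ga hb; rewrite -[- b]mulN1r.
have -> : (fun x => g x - h x) = (fun x => g x + -1 * h x).
  by apply/funext => x; rewrite mulN1r.
apply: (@tendsD V FV g (fun x => -1 * h x) a (-1 * b) ga); exact: tendsZ.
Qed.

Lemma tends_le V {FV : ProperFilter V} g l (B : R) :
  tends V g l -> V [set x | abs (g x) <= B] -> abs l <= B.
Proof.
move=> gl gB; apply/ler_addgt0Pr => e e0.
have [x [/= gx gBx]] := filter_ex (filterI (gl e e0) gB).
have := absB F (g x) (g x - l); rewrite subKr; lra.
Qed.

Lemma tends_unique V {FV : ProperFilter V} g a b : tends V g a -> tends V g b -> a = b.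
Proof.
move=> ga gb; apply/eqP; rewrite -subr_eq0; apply/eqP/(@abs_eq0 _ _ F).
apply/eqP; rewrite eq_le abs_ge0 andbT.
apply: (tends_le (tendsB ga gb)).
by apply: filterS filterT => x _ /=; rewrite subrr abs0.
Qed.

Section Ultra.
Variables (V : set_system X) (UV : UltraFilter V).

Lemma ultra_real_limit (h : X -> R) (B : R) : V [set x | `|h x| <= B] ->
  exists l, forall e : R, 0 < e -> V [set x | `|h x - l| < e].
Proof.
move=> hB; pose A := [set t | V [set x | t <= h x]].
have AB t : A t -> t <= B.
  move=> At; have [x [/= tx]] := filter_ex (filterI At hB).
  by move=> /ler_normlP[_]; exact: le_trans.
have A0 : has_sup A.
  split; last by exists B => t /AB.
  by exists (- B); apply: filterS hB => x /= /ler_normlP[]; rewrite lerNl.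
exists (sup A) => e e0; have e20 : 0 < e / 2 by rewrite divr_gt0.
have [t At te] := sup_adherent e0 A0.
have nA : ~ A (sup A + e / 2).
  by move=> /(ub_le_sup A0.2); lra.
have [//|Ah] := in_ultra_setVsetC [set x | sup A + e / 2 <= h x] UV.
apply: filterS (filterI At Ah) => x [/= tx /negP]; rewrite -ltNge => hx.
by rewrite ltr_distl; apply/andP; split; lra.
Qed.

Lemma ultra_limit g (B : R) : V [set x | abs (g x) <= B] -> exists l, tends V g l.
Proof.
move=> gB.
have [l1 gl1] : exists l, forall e : R, 0 < e -> V [set x | `|re (g x) - l| < e].
  apply: (@ultra_real_limit _ B); apply: filterS gB => x /=.
  by apply: le_trans; exact: rpart_le.
have [l2 gl2] : exists l, forall e : R, 0 < e -> V [set x | `|re (rot F * g x) - l| < e].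
  apply: (@ultra_real_limit _ B); apply: filterS gB => x /=.
  apply: le_trans; apply: le_trans (rpart_le F _) _.
  rewrite -/(abs _) absM ler_piMl ?abs_ge0//; exact: abs_rot.
exists (l1%:K + unit2 F * l2%:K) => e e0.
have e20 : 0 < e / 2 by rewrite divr_gt0.
apply: filterS (filterI (gl1 _ e20) (gl2 _ e20)) => x [/= h1 h2].
rewrite {1}(coordinates F (g x)) opprD addrACA -rmorphB -mulrBr -rmorphB.
apply: le_lt_trans (absD _ _ _) _; rewrite absM.
have := abs_emb_le F (re (g x) - l1).
have : abs (unit2 F) * abs (re (rot F * g x) - l2)%:K <= `|re (rot F * g x) - l2|.
  by apply: le_trans _ (abs_emb_le F _); rewrite ler_piMl ?abs_ge0 ?abs_unit2.
lra.
Qed.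

Definition ulim g : K := xget 0 (tends V g).

Lemma ulimP g (B : R) : V [set x | abs (g x) <= B] -> tends V g (ulim g).
Proof.
move=> /ultra_limit[l gl].
by rewrite /ulim; apply: (@xgetPex _ 0 (tends V g)); exists l.
Qed.

(** Bounded pointwise ultralimits of functionals are functionals: the
    weak-star compactness of the dual ball. *)
Lemma functional_ulim (Y : normedModType K) (C : R) (f : X -> Y -> K) :
  (forall x, functional F C (f x)) ->
  functional F C (fun v => ulim (f^~ v)) /\
  forall v, tends V (f^~ v) (ulim (f^~ v)).
Proof.
move=> fC.
have lim v : tends V (f^~ v) (ulim (f^~ v)).
  by apply: (@ulimP _ (C * N v)); apply: filterS filterT => x _; exact: (fC x).2.
split=> //; split=> [a v w|v].
  apply: (tends_unique (lim _)).
  apply: tends_near (tendsD (tendsZ a (lim v)) (lim w)).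
  by apply: filterS filterT => x _ /=; rewrite (fC x).1.
by apply: (tends_le (lim v)); apply: filterS filterT => x _; exact: (fC x).2.
Qed.

End Ultra.
End Limits.

(** * Weak topology and weak compactness *)

Section Dual.
Variable Y : normedModType K.

Lemma functional_dual (C : R) (f : Y -> K) : functional F C f ->
  exists D : dual Y, forall v, sval D v = f v.
Proof.
move=> fC.
have fadd : additive (f : Y -> K^o) by move=> v w; exact: (functionalB fC).
have fscal : scalable (f : Y -> K^o) by move=> a v; exact: (functionalZ fC).
pose fa := GRing.isZmodMorphism.Build Y K^o f fadd.
pose fs := GRing.isScalable.Build K Y K^o *:%R f fscal.
pose fl : {linear Y -> K^o} := HB.pack_for {linear Y -> K^o} (f : Y -> K^o) fa fs.
suff cf : continuous fl by exists (exist _ fl cf).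
apply/linear_bounded_continuous/linear_boundedP.
exists (C%:K); split; first exact: real_emb.
move=> r Cr v.
have -> : `|fl v| = (abs (f v))%:K by exact: absE.
rewrite (rnormE F); apply: (@le_trans _ _ (C * N v)%:K).
  by rewrite emb_le; exact: fC.2.
by rewrite rmorphM; apply: ler_wpM2r; [rewrite -rnormE|exact: ltW].
Qed.

Lemma dual_functional (D : dual Y) : exists2 C, 0 <= C & functional F C (sval D).
Proof.
have : bounded_near (sval D) (nbhs 0) by apply/linear_bounded_continuous/(svalP D).
move=> /linear_boundedP[M [Mr MP]].
exists (`|re M| + 1); first by rewrite addr_ge0.
split=> [a v w|v]; first by rewrite linearP.
have /MP/(_ v) : M < (`|re M| + 1)%:K.
  have [r ->] := real_embP F Mr.
  by rewrite emb_lt re_emb; have := ler_norm r; lra.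
have -> : `|sval D v| = (abs (sval D v))%:K by exact: absE.
by rewrite (rnormE F) -rmorphM emb_le.
Qed.

Lemma weak_cvg (G : set_system Y) (y : Y) : Filter G ->
  (forall D : dual Y, tends G (sval D) (sval D y)) -> G --> (y : weak_space Y).
Proof.
move=> FG GD S; rewrite nbhsE => -[B [[C Copen <-] Cy] BS].
apply: filterS BS _.
suff : (@weak_eval _ Y : Y -> {ptws dual Y -> K^o}) @ G --> (weak_eval y : {ptws dual Y -> K^o}).
  by apply; exact: open_nbhs_nbhs.
apply/cvg_sup => D S'; rewrite nbhsE => -[B' [[C' Copen' <-] Cy'] BS'].
apply: filterS BS' _.
have /nbhs_ballP[e /= e0 eC] : nbhs (sval D y : K^o) C' by exact: open_nbhs_nbhs.
have re0 : 0 < re e by rewrite -(emb_lt F) embK ?rmorph0// ltW.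
suff : G (fun v => C' (sval D v)) by [].
apply: filterS (GD D _ re0) => v /= De; apply: eC.
rewrite -ball_normE/= distrC.
have -> : `|(sval D v : K^o) - sval D y| = (abs (sval D v - sval D y))%:K by exact: absE.
by rewrite -[e](embK F) ?ltW// emb_lt.
Qed.

Lemma weak_nbhs (D : dual Y) (y : Y) (e : R) : 0 < e ->
  nbhs (y : weak_space Y) [set v | abs (sval D v - sval D y) < e].
Proof.
move=> e0.
have : nbhs (sval D y : K^o) (ball (sval D y : K^o) e%:K).
  by apply: nbhsx_ballx; rewrite -(rmorph0 (emb F)) emb_lt.
move=> /(@initial_continuous _ _ (fun f : {ptws dual Y -> K^o} => f D) (weak_eval y)).
have /cvg_sup/(_ D) : nbhs (weak_eval y : {ptws dual Y -> K^o}) --> weak_eval y by [].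
move=> /[apply] /(@initial_continuous _ _ (@weak_eval _ Y) y) yD.
suff : nbhs (y : weak_space Y) (fun v => ball (sval D y : K^o) e%:K (sval D v)).
  apply: filterS => v; rewrite -ball_normE/= distrC.
  have -> : `|(sval D v : K^o) - sval D y| = (abs (sval D v - sval D y))%:K by exact: absE.
  by rewrite emb_lt.
exact: yD.
Qed.

Lemma weakly_compact_limit (B : set Y) (X : Type) (V : set_system X) (u : X -> Y) :
  relatively_weakly_compact B -> UltraFilter V -> V [set x | B (u x)] ->
  exists y, forall D : dual Y, tends V (fun x => sval D (u x)) (sval D y).
Proof.
move=> Bc UV uB.
have [|y [_ yc]] := Bc (u @ V) _.
  by apply: filterS uB => x; exact: (@subset_closure (weak_space Y)).
exists y => D e e0.
have [//|nD] := in_ultra_setVsetC [set x | abs (sval D (u x) - sval D y) < e] UV.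
have uD : (u @ V) [set v | ~ abs (sval D v - sval D y) < e] by [].
by have [v []] := yc _ _ uD (weak_nbhs D y e0).
Qed.

(** An ultrafilter without weak limit lives on the weak closure of the image; the
    weakly open sets that it contains meet the image itself and pull it back to
    [P]. *)
Lemma not_weakly_compact_ultrafilter (X : Type) (u : X -> Y) (P : set X) :
  ~ relatively_weakly_compact (u @` P) ->
  exists V : set_system X, [/\ UltraFilter V, V P &
    forall y, ~ forall D : dual Y, tends V (fun x => sval D (u x)) (sval D y)].
Proof.
rewrite /relatively_weakly_compact compact_ultra => nc.
have {nc}[G [UG Gcl Gy]] : exists G : set_system (weak_space Y), [/\ UltraFilter G,
    G (@closure (weak_space Y) (u @` P)) & forall y, ~ G --> (y : weak_space Y)].
  apply: contrapT => nG; apply: nc => G UG Gcl; apply: contrapT => Gy.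
  apply: nG; exists G; split=> // y GGy; apply: Gy; exists y; split=> //.
  have cl := @closed_closure (weak_space Y) (u @` P).
  apply: cl => O Oy; exact: filter_ex (filterI Gcl (GGy _ Oy)).
pose V0 : set_system X := [set S | exists O : set (weak_space Y),
  [/\ open O, G O & P `&` u @^-1` O `<=` S]].
have properV0 : ProperFilter V0.
  split.
    move=> [U [Uo GU PU]]; have [v [vcl Uv]] := filter_ex (filterI Gcl GU).
    have [_ [[x Px <-] Uux]] := vcl U (open_nbhs_nbhs (conj Uo Uv)).
    exact: (PU x).
  split.
  - by exists setT; split=> //; [exact: openT|exact: filterT].
  - move=> S1 S2 [U1 [U1o GU1 PU1]] [U2 [U2o GU2 PU2]].
    exists (U1 `&` U2); split; [exact: openI|exact: filterI|].
    by move=> x [Px [U1x U2x]]; split; [exact: PU1|exact: PU2].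
  - move=> S1 S2 S12 [U [Uo GU PU]]; exists U; split=> //.
    exact: subset_trans PU S12.
have [V [UV V0V]] := ultraFilterLemma properV0.
exists V; split=> //.
  by apply: V0V; exists setT; split; [exact: openT|exact: filterT|move=> x []].
move=> y Vy; apply: (Gy y); apply: weak_cvg => D e e0.
have e20 : 0 < e / 2 by rewrite divr_gt0.
have [//|nD] := in_ultra_setVsetC [set v | abs (sval D v - sval D y) < e] UG.
pose O : set (weak_space Y) := [set v | e / 2 < abs (sval D v - sval D y)].
have Oo : open O.
  rewrite openE => v /= Ov; have d0 : 0 < abs (sval D v - sval D y) - e / 2.
    by rewrite subr_gt0.
  apply: filterS (weak_nbhs D v d0) => w /=; rewrite /O/=.
  have := absD F (sval D v - sval D w) (sval D w - sval D y).
  by rewrite addrA subrK (abs_distC F (sval D v) (sval D w)); lra.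
have GO : G O by apply: filterS nD => v /= /negP; rewrite -leNgt /O/=; lra.
have VO : V [set x | O (u x)].
  by apply: V0V; exists O; split=> // x [].
have [x [/=]] := filter_ex (filterI VO (Vy D _ e20)).
by rewrite /O/=; lra.
Qed.

End Dual.
End UltraLimits.

(** * Extraction of basic sequences *)

Lemma history_choice (D : Type) (Q : seq D -> D -> Prop) :
  (forall h, exists d, Q h d) -> exists r : nat -> D, forall j, Q (mkseq r j) (r j).
Proof.
move=> /choice[g gQ]; pose L := fix L j := if j is j'.+1 then rcons (L j') (g (L j')) else [::].
exists (fun j => g (L j)) => j.
suff -> : mkseq (fun j => g (L j)) j = L j by exact: gQ.
by elim: j => // j IH; rewrite mkseqS IH.
Qed.

Lemma take_mkseq (D : Type) (r : nat -> D) k l : (k <= l)%N ->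
  take k (mkseq r l) = mkseq r k.
Proof. by move=> kl; rewrite /mkseq -map_take take_iota (minn_idPl kl). Qed.

Section Mazur.
Variables (R : realType) (K : numFieldType) (F : real_coordinates R K).
Local Notation re := (rpart F).
Local Notation abs := (abs F).
Local Notation N := (rnorm F).

Lemma sum_half_powers n : \sum_(0 <= l < n) (2^-1 : R) ^+ l.+1 <= 1.
Proof.
suff -> : \sum_(0 <= l < n) (2^-1 : R) ^+ l.+1 = 1 - 2^-1 ^+ n.
  by rewrite gerBl exprn_ge0// invr_ge0.
elim: n => [|n IH]; first by rewrite big_geq// expr0 subrr.
by rewrite big_nat_recr//= IH !exprS; field.
Qed.

Section Nets.
Variable I : Type.

Lemma real_cells (P : set I) (h : I -> R) (M e : R) : 0 < e ->
  (forall i, P i -> `|h i| <= M) ->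
  exists (T : finType) (c : I -> T), forall i j, P i -> P j -> c i = c j ->
    `|h i - h j| <= e.
Proof.
move=> e0 hM; pose t i := Num.trunc ((h i + M) / e).
pose n := Num.trunc ((M + M) / e).
have hi i : P i -> (t i <= n)%N /\ (t i)%:R * e <= h i + M < (t i).+1%:R * e.
  move=> Pi; have := hM i Pi; rewrite ler_norml => /andP[h1 h2].
  have p0 : 0 <= (h i + M) / e by rewrite divr_ge0 ?(ltW e0)//; lra.
  split; last by rewrite -ler_pdivlMr// -ltr_pdivrMr// truncn_itv.
  by apply: Num.Theory.le_truncn; rewrite ler_pM2r ?invr_gt0//; lra.
exists 'I_n.+1, (fun i => inord (t i)) => i j Pi Pj /(congr1 val) /=.
have [ni /andP[i1 i2]] := hi i Pi; have [nj /andP[j1 j2]] := hi j Pj.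
rewrite !inordK ?ltnS// => tij; rewrite tij in i1 i2.
move: j1 j2 i1 i2; rewrite -natr1 mulrDl mul1r; move: (_ * e) => te *.
by rewrite ler_norml; apply/andP; split; lra.
Qed.

(** This is the total boundedness of the set of values taken by [P] at finitely
    many vectors. *)
Lemma finite_cells (P : set I) (k : nat) (z : nat -> I -> K) (e : R) : 0 < e ->
  (forall m, (m < k)%N -> exists M, forall i, P i -> abs (z m i) <= M) ->
  exists (T : finType) (c : I -> T), forall i j, P i -> P j -> c i = c j ->
    forall m, (m < k)%N -> abs (z m i - z m j) <= e.
Proof.
move=> e0; elim: k => [_|k IH zM]; first by exists unit, (fun=> tt).
have [|T [c cP]] := IH; first by move=> m mk; apply: zM; exact: ltnW.
have [M zkM] := zM k (ltnSn k).
have e20 : 0 < e / 2 by rewrite divr_gt0.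
have [|T1 [c1 c1P]] := @real_cells P (fun i => re (z k i)) M _ e20.
  by move=> i /zkM; apply: le_trans; exact: rpart_le.
have [|T2 [c2 c2P]] := @real_cells P (fun i => re (rot F * z k i)) M _ e20.
  move=> i /zkM; apply: le_trans; apply: le_trans (rpart_le F _) _.
  rewrite -/(abs _) absM ler_piMl ?abs_ge0//; exact: abs_rot.
exists (T * (T1 * T2))%type, (fun i => (c i, (c1 i, c2 i))) => i j Pi Pj [cij c1ij c2ij] m.
rewrite ltnS leq_eqVlt => /predU1P[->|]; last exact: cP.
apply: le_trans (abs_coordinates _ _) _.
rewrite mulrBr !rpartD !reN.
have := c1P _ _ Pi Pj c1ij; have := c2P _ _ Pi Pj c2ij; lra.
Qed.

End Nets.

Lemma finite_net (I : eqType) (P : set I) (k : nat) (z : nat -> I -> K) (e : R) :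
  0 < e ->
  (forall m, (m < k)%N -> exists M, forall i, P i -> abs (z m i) <= M) ->
  exists s : seq I, (forall i, i \in s -> P i) /\ forall i, P i ->
    exists2 j, j \in s & forall m, (m < k)%N -> abs (z m i - z m j) <= e.
Proof.
move=> e0 /(finite_cells e0)[T [c cP]].
pose rep t := [set o : option I | if o is Some i then P i /\ c i = t else
  forall i, P i -> c i <> t].
have /choice[g gP] t : exists o, rep t o.
  have [[i Pi]|no] := pselect (exists i, P i /\ c i = t); first by exists (Some i).
  by exists None => i Pi ci; apply: no; exists i.
exists (pmap g (enum T)); split.
  by move=> i; rewrite mem_pmap => /mapP[t _ /esym gt]; have := gP t; rewrite gt => -[].
move=> i Pi; have := gP (c i); case gi : (g (c i)) => [j|]; last by move=> /(_ i Pi).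
move=> [Pj cj]; exists j; last exact: cP.
by rewrite mem_pmap -gi; apply: map_f; rewrite mem_enum.
Qed.

(** Mazur's selection. Every new vector is almost annihilated by a finite set of
    functionals which is a net, with respect to the previous vectors, of [P true]
    and of [P false]; two sets allow a simultaneous selection in the domain and in
    the range of an operator. *)
Lemma mazur_selection (I : eqType) (P : bool -> set I) (D : Type)
    (ev : D -> I -> K) (ok : seq D -> D -> Prop) (eta : R) (d0 : D) :
  0 < eta ->
  (forall d b, exists M, forall i, P b i -> abs (ev d i) <= M) ->
  (forall (h : seq D) (s : seq I) (e : R), 0 < e ->
    (forall i, i \in s -> exists b, P b i) ->
    exists d, ok h d /\ forall i, i \in s -> abs (ev d i) <= e) ->
  exists r : nat -> D, [/\ r 0%N = d0,
    forall k, ok (mkseq r k.+1) (r k.+1) &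
    forall b k i, P b i -> exists j, [/\ P b j,
      forall l, (l <= k)%N -> abs (ev (r l) i - ev (r l) j) <= eta / k.+1%:R
    & forall l, (k < l)%N -> abs (ev (r l) j) <= eta * 2^-1 ^+ l.+1]].
Proof.
move=> eta0 evM evs.
pose isnet (h : seq D) (s : seq I) :=
  (forall i, i \in s -> exists b, P b i) /\
  forall b i, P b i -> exists j, [/\ j \in s, P b j &
    forall l, (l < size h)%N ->
      abs (ev (nth d0 h l) i - ev (nth d0 h l) j) <= eta / (size h)%:R].
have /choice[net netP] h : exists s, isnet h s.
  have nb b : exists s : seq I, (forall i, i \in s -> P b i) /\ forall i, P b i ->
      exists2 j, j \in s & forall l, (l < size h)%N ->
        abs (ev (nth d0 h l) i - ev (nth d0 h l) j) <= eta / (size h)%:R.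
    case: h => [|d h].
      have [[i Pi]|no] := pselect (exists i, P b i).
        exists [:: i]; split=> [j|j _]; first by rewrite inE => /eqP->.
        by exists i; rewrite ?inE.
      by exists [::]; split=> // i Pi; exfalso; apply: no; exists i.
    apply: finite_net => [|m _]; first by rewrite divr_gt0// ltr0n.
    exact: evM.
  have [s1 [s1P n1]] := nb true; have [s2 [s2P n2]] := nb false.
  exists (s1 ++ s2); split.
    by move=> i; rewrite mem_cat => /orP[/s1P|/s2P]; [exists true|exists false].
  by case=> i => [/n1|/n2] [j js jP]; exists j; split; rewrite ?mem_cat ?js ?orbT//;
    [exact: s1P|exact: s2P].
pose nets (h : seq D) := flatten [seq net (take m h) | m <- iota 0 (size h).+1].
pose Q (h : seq D) d := if h is [::] then d = d0 else
  ok h d /\ forall i, i \in nets h -> abs (ev d i) <= eta * 2^-1 ^+ (size h).+1.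
have [|r rP] := @history_choice D Q.
  case=> [|d h]; first by exists d0.
  apply: evs; first by rewrite mulr_gt0// exprn_gt0// invr_gt0.
  by move=> i /flattenP[_ /mapP[m _ ->]]; exact: (netP _).1.
exists r; split; first exact: (rP 0%N).
  by move=> k; case: (rP k.+1).
move=> b k i Pi; have [_ /(_ b i Pi)[j [js Pj jP]]] := netP (mkseq r k.+1).
rewrite size_mkseq in jP.
exists j; split=> //.
  by move=> l lk; have := jP l lk; rewrite nth_mkseq.
case=> // l kl; have [_] := rP l.+1; rewrite size_mkseq; apply.
apply/flattenP; exists (net (mkseq r k.+1)) => //; apply/mapP; exists k.+1.
  by rewrite mem_iota size_mkseq/= add0n !ltnS.
by rewrite take_mkseq.
Qed.

(** The selected vectors form a basic sequence for the seminorm defined by [P],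
    with partial sum projections of norm at most 2. The errors of the selection
    are proportional to the largest coefficient, which is bounded in terms of the
    projections because the vectors have norm at least [kappa]; the constant 1/8
    lets them be absorbed. *)
Lemma mazur_inequality (I : Type) (P : set I) (z : nat -> I -> K) (kappa : R) :
  0 < kappa ->
  (forall k i, P i -> exists j, [/\ P j,
     forall l, (l <= k)%N -> abs (z l i - z l j) <= kappa / 8 / k.+1%:R
   & forall l, (k < l)%N -> abs (z l j) <= kappa / 8 * 2^-1 ^+ l.+1]) ->
  (forall l, exists2 i, P i & kappa <= abs (z l i)) ->
  forall n (b : nat -> K) (B : R),
    (forall j, P j -> abs (\sum_(0 <= l < n.+1) b l * z l j) <= B) ->
  (forall l, (l <= n)%N -> kappa * abs (b l) <= 4 * B) /\
  (forall k i, (k <= n)%N -> P i ->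
     abs (\sum_(0 <= l < k.+1) b l * z l i) <= 2 * B).
Proof.
move=> k0 znet zlow n b B bB; set eta := kappa / 8.
have eta0 : 0 < eta by rewrite divr_gt0.
pose beta := \big[Num.max/0]_(0 <= l < n.+1) abs (b l).
have beta0 : 0 <= beta by exact: bigmax_ge_id.
have bbeta l : (l <= n)%N -> abs (b l) <= beta.
  by move=> ln; apply: (le_bigmax_seq _ l) => //; rewrite mem_index_iota.
have part k i : (k <= n)%N -> P i ->
    abs (\sum_(0 <= l < k.+1) b l * z l i) <= B + 2 * beta * eta.
  move=> kn Pi; have [j [Pj zk zl]] := znet k i Pi.
  have near : abs (\sum_(0 <= l < k.+1) b l * (z l i - z l j)) <= beta * eta.
    apply: le_trans (abs_sum _ _ _ _) _.
    apply: (@le_trans _ _ (\sum_(0 <= l < k.+1) beta * (eta / k.+1%:R))).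
      rewrite !big_nat; apply: ler_sum => l /andP[_ lk]; rewrite absM.
      by apply: ler_pM; rewrite ?abs_ge0 ?bbeta ?zk//; lia.
    rewrite sumr_const_nat subn0 -mulrnAr ler_wpM2l//.
    by rewrite -mulr_natr divfK// pnatr_eq0.
  have tail : abs (\sum_(k.+1 <= l < n.+1) b l * z l j) <= beta * eta.
    apply: le_trans (abs_sum _ _ _ _) _.
    apply: (@le_trans _ _ (\sum_(k.+1 <= l < n.+1) beta * eta * 2^-1 ^+ l.+1)).
      rewrite !big_nat; apply: ler_sum => l /andP[kl ln]; rewrite absM -mulrA.
      by apply: ler_pM; rewrite ?abs_ge0 ?bbeta ?zl.
    rewrite -mulr_sumr; apply: ler_piMr; first by rewrite mulr_ge0// ltW.
    apply: le_trans (sum_half_powers n.+1).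
    rewrite [leRHS](@big_cat_nat _ _ _ k.+1)//= lerDr.
    by apply: sumr_ge0 => l _; rewrite exprn_ge0// invr_ge0.
  have all := bB j Pj; rewrite (@big_cat_nat _ _ _ k.+1)//= in all.
  set t := \sum_(k.+1 <= l < n.+1) _ in tail all.
  set h := \sum_(0 <= l < k.+1) b l * z l j in all.
  have -> : \sum_(0 <= l < k.+1) b l * z l i =
      \sum_(0 <= l < k.+1) b l * (z l i - z l j) + h.
    by rewrite -big_split/=; apply: eq_bigr => l _; ring.
  apply: le_trans (absD _ _ _) _.
  have := absB F (h + t) t; rewrite addrK; lra.
have B0 : 0 <= B.
  by have [i Pi _] := zlow 0%N; exact: le_trans (abs_ge0 _ _) (bB i Pi).
have coef l : (l <= n)%N -> kappa * abs (b l) <= 2 * B + 4 * beta * eta.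
  move=> ln; have [i Pi zi] := zlow l.
  have : kappa * abs (b l) <= abs (b l * z l i).
    by rewrite absM mulrC ler_wpM2l// abs_ge0.
  move=> /le_trans; apply.
  have p1 := part l i ln Pi; case: l ln zi p1 => [|l] ln _ p1.
    move: p1; rewrite big_nat1; have : 0 <= beta * eta by rewrite mulr_ge0// ltW.
    lra.
  have p2 := part l i (ltnW ln) Pi.
  move: p1; rewrite big_nat_recr//=; set s := \sum_(0 <= _ < _) _ in p2 *; move=> p1.
  have := absB F (s + b l.+1 * z l.+1 i) s; rewrite addrC addKr; lra.
have kbeta : kappa * beta <= 4 * B.
  suff : kappa * beta <= 2 * B + 4 * beta * eta by rewrite /eta; lra.
  have /bigmax_le Mle : 0 <= (2 * B + 4 * beta * eta) / kappa.
    by rewrite divr_ge0 ?(ltW k0)// addr_ge0 ?mulr_ge0// ltW.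
  rewrite mulrC -ler_pdivlMr// {1}/beta big_nat; apply: Mle => l ln.
  by rewrite ler_pdivlMr// mulrC coef.
split=> [l ln|k i kn Pi].
  by apply: le_trans kbeta; rewrite ler_wpM2l ?bbeta// ltW.
apply: le_trans (part k i kn Pi) _; rewrite /eta; lra.
Qed.

(** * Basic sequences in normed spaces *)

Section Basic.
Variable X : normedModType K.
Implicit Types x : nat -> X.

Lemma seq_cvgP (u : nat -> X) (v : X) :
  (u n @[n --> \oo] --> v) <->
  forall e : R, 0 < e -> exists n0, forall n, (n0 <= n)%N -> N (v - u n) < e.
Proof.
split=> [/cvgrPdist_lt uv e e0|uv].
  have /uv[n0 _ n0P] : 0 < emb F e by rewrite -(rmorph0 (emb F)) emb_lt.
  exists n0 => n /n0P /=; by rewrite (rnormE F) emb_lt.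
apply/cvgrPdist_lt => e e0.
have re0 : 0 < re e by rewrite -(emb_lt F) embK ?rmorph0// ltW.
have [n0 n0P] := uv _ re0; exists n0 => // n /= /n0P.
by rewrite -(emb_lt F) -rnormE embK// ltW.
Qed.

Lemma closureP (S : set X) (v : X) (e : R) : closure S v -> 0 < e ->
  exists2 w, S w & N (v - w) < e.
Proof.
move=> Sv e0.
have [|w [Sw]] := Sv (ball v (emb F e)).
  by apply: nbhsx_ballx; rewrite -(rmorph0 (emb F)) emb_lt.
by rewrite -ball_normE/= (rnormE F) emb_lt => vw; exists w.
Qed.

Lemma partial_sumS x a n : partial_sum x a n.+1 = partial_sum x a n + a n.+1 *: x n.+1.
Proof. by rewrite /partial_sum big_nat_recr. Qed.

Lemma partial_sumB x a b n :
  partial_sum x (fun i => a i - b i) n = partial_sum x a n - partial_sum x b n.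
Proof.
by rewrite /partial_sum -sumrB; apply: eq_bigr => i _; rewrite scalerBl.
Qed.

Lemma nat_ultrafilter : exists V : set_system nat, UltraFilter V /\
  forall n, V [set m | (n <= m)%N].
Proof.
have [V [UV ooV]] := ultraFilterLemma eventually_filter.
by exists V; split=> // n; apply: ooV; exists n.
Qed.

(** Grunblum's criterion. The projections keep the coordinates of finite
    combinations approximating [v] bounded, and the coordinates of [v] are their
    ultralimits. *)
Lemma basic_criterion x (C c : R) : 0 < c -> 0 <= C ->
  (forall i, (0 < i)%N -> c <= N (x i)) ->
  (forall a m n, (m <= n)%N -> N (partial_sum x a m) <= C * N (partial_sum x a n)) ->
  basic_sequence x.
Proof.
move=> c0 C0 xc xC.
have coef a i n : (0 < i <= n)%N -> c * abs (a i) <= 2 * C * N (partial_sum x a n).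
  move=> /andP[i0 ni]; case: i i0 ni => // i _ ni.
  have h1 := xC a _ _ ni; have h2 := xC a _ _ (ltnW ni).
  have : N (a i.+1 *: x i.+1) <= 2 * C * N (partial_sum x a n).
    have := rnormB F (partial_sum x a i.+1) (partial_sum x a i).
    by rewrite {1}partial_sumS addrC addKr; lra.
  by apply: le_trans; rewrite rnormZ mulrC ler_wpM2l ?abs_ge0// xc.
move=> v xv.
have /choice[f fP] k : exists nb : nat * (nat -> K),
    (forall i, (nb.1 < i)%N -> nb.2 i = 0) /\
    N (v - partial_sum x nb.2 nb.1) < k.+1%:R^-1.
  have k0 : 0 < (k.+1%:R^-1 : R) by rewrite invr_gt0.
  have [_ [n [b ->]] vb] := closureP xv k0.
  exists (n, fun i => if (i <= n)%N then b i else 0); split=> /=.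
    by move=> i; rewrite ltnNge => /negPf->.
  suff -> : partial_sum x (fun i => if (i <= n)%N then b i else 0) n = partial_sum x b n by [].
  by rewrite /partial_sum !big_nat; apply: eq_bigr => i /andP[_]; rewrite ltnS => ->.
pose n_ k := (f k).1; pose b_ k := (f k).2.
have b_const k m : (n_ k <= m)%N -> partial_sum x (b_ k) m = partial_sum x (b_ k) (n_ k).
  elim: m => [|m IH]; first by rewrite leqn0 => /eqP->.
  rewrite leq_eqVlt => /predU1P[->//|]; rewrite ltnS => nm.
  by rewrite partial_sumS IH// /b_ (fP k).1 ?ltnS// scale0r addr0.
pose w k := partial_sum x (b_ k) (n_ k).
have vw k : N (v - w k) < k.+1%:R^-1 by exact: (fP k).2.
have ww k l : (k <= l)%N -> N (w k - w l) <= 2 * k.+1%:R^-1.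
  move=> kl; have := rnormD F (w k - v) (v - w l); rewrite addrA subrK.
  rewrite (rnorm_distC F (w k) v); have := vw k; have := vw l.
  have : (l.+1%:R^-1 : R) <= k.+1%:R^-1 by rewrite lef_pV2 ?posrE// ler_nat ltnS.
  by move: (k.+1%:R^-1) (l.+1%:R^-1) => ik il; lra.
have bb k l m : (k <= l)%N -> N (partial_sum x (b_ k) m - partial_sum x (b_ l) m) <=
    C * (2 * k.+1%:R^-1).
  move=> kl; pose M := maxn m (maxn (n_ k) (n_ l)).
  rewrite -partial_sumB.
  have /xC/le_trans : (m <= M)%N by exact: leq_maxl.
  apply; rewrite ler_wpM2l// partial_sumB !b_const; first exact: ww.
    by rewrite /M; lia.
  by rewrite /M; lia.
have [V [UV ooV]] := nat_ultrafilter.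
have blim i : (0 < i)%N -> tends F V (b_ ^~ i) (ulim F V (b_ ^~ i)).
  move=> i0; pose B := 2 * C * (N (partial_sum x (b_ 0%N) i) + C * 2) / c.
  apply: (@ulimP _ _ F _ V UV _ B); apply: filterS filterT => k _ /=.
  rewrite ler_pdivlMr// mulrC; apply: le_trans (coef _ i i _) _; first by rewrite i0/=.
  rewrite ler_wpM2l ?mulr_ge0//.
  have := bb 0%N k i (leq0n k); rewrite invr1 mulr1.
  have := rnormB F (partial_sum x (b_ 0%N) i) (partial_sum x (b_ 0%N) i - partial_sum x (b_ k) i).
  by rewrite subKr; lra.
pose a i := ulim F V (b_ ^~ i).
have Plim m (e : R) : 0 < e ->
    V [set k | N (partial_sum x (b_ k) m - partial_sum x a m) < e].
  elim: m e => [|m IH] e e0.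
    by apply: filterS filterT => k _ /=; rewrite /partial_sum !big_geq// subr0 rnorm0.
  have e20 : 0 < e / 2 by rewrite divr_gt0.
  have d0 : 0 < e / 2 / (N (x m.+1) + 1) by rewrite divr_gt0// ltr_wpDl// rnorm_ge0.
  apply: filterS (filterI (IH _ e20) (blim m.+1 isT _ d0)) => k [/= h1].
  rewrite ltr_pdivlMr ?ltr_wpDl ?rnorm_ge0// => h2.
  rewrite !partial_sumS opprD addrACA -scalerBl.
  apply: le_lt_trans (rnormD F _ _) _; rewrite rnormZ.
  have := abs_ge0 F (b_ k m.+1 - a m.+1).
  rewrite /a in h2 *; lra.
have va : partial_sum x a n @[n --> \oo] --> v.
  apply/seq_cvgP => e e0.
  pose k := Num.trunc ((1 + C * 2) / e).
  have p0 : 0 <= (1 + C * 2) / e by rewrite divr_ge0 ?(ltW e0)//; lra.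
  have ke : (1 + C * 2) * k.+1%:R^-1 < e.
    have /andP[_] := truncn_itv p0; rewrite -/k.
    by rewrite ltr_pdivrMr// => ke; rewrite ltr_pdivrMr ?ltr0Sn// [e * _]mulrC.
  exists (n_ k) => m km.
  pose d := e - (1 + C * 2) * k.+1%:R^-1.
  have d0 : 0 < d by rewrite subr_gt0.
  have [l [/= lk lP]] := filter_ex (filterI (ooV k) (Plim m d d0)).
  have := bb _ _ m lk; rewrite (b_const k m km) -/(w k); have := vw k.
  have := rnormD F (v - w k) (w k - partial_sum x a m); rewrite addrA subrK.
  have := rnormD F (w k - partial_sum x (b_ l) m) (partial_sum x (b_ l) m - partial_sum x a m).
  rewrite addrA subrK.
  by move: lP; rewrite /d; move: (k.+1%:R^-1) => ik; lra.
exists a; split=> // b vb i i0.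
apply/eqP; rewrite -subr_eq0; apply/eqP/(@abs_eq0 _ _ F)/eqP.
rewrite eq_le abs_ge0 andbT.
suff : c * abs (b i - a i) <= 0 by rewrite pmulr_rle0.
apply/ler_addgt0Pr => e e0; rewrite add0r.
have d0 : 0 < e / (4 * C + 1) by rewrite divr_gt0//; lra.
have [n1 n1P] := (seq_cvgP _ _).1 vb _ d0; have [n2 n2P] := (seq_cvgP _ _).1 va _ d0.
pose n := maxn i (maxn n1 n2).
have := coef (fun i => b i - a i) i n; rewrite i0 leq_maxl => /(_ isT)/le_trans; apply.
rewrite partial_sumB.
have h1 := n1P n; have h2 := n2P n.
have := rnormD F (v - partial_sum x a n) (partial_sum x b n - v).
rewrite [v - _ + _]addrC addrA subrK (rnorm_distC F _ v) => h3.
have {}h1 : N (v - partial_sum x b n) < e / (4 * C + 1) by apply: h1; rewrite /n; lia.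
have {}h2 : N (v - partial_sum x a n) < e / (4 * C + 1) by apply: h2; rewrite /n; lia.
apply: (@le_trans _ _ (2 * C * (2 * (e / (4 * C + 1))))).
  by rewrite ler_wpM2l ?mulr_ge0//; lra.
rewrite -subr_ge0.
have -> : e - 2 * C * (2 * (e / (4 * C + 1))) = e / (4 * C + 1) by field; lra.
exact: ltW.
Qed.

End Basic.
End Mazur.

(** * Real-valued forms of the definitions *)

Lemma big_fset_nat (V : nmodType) (E : {fset nat}) (f : nat -> V) n :
  0%N \notin E -> (forall i, i \in E -> (i <= n)%N) ->
  \sum_(i <- E) f i = \sum_(1 <= i < n.+1 | i \in E) f i.
Proof.
move=> E0 En; rewrite -[RHS]big_filter; apply: perm_big; apply: uniq_perm.
- exact: fset_uniq.
- by rewrite filter_uniq// iota_uniq.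
move=> i; rewrite mem_filter mem_index_iota ltnS.
case iE : (i \in E); rewrite ?andbF//= En// andbT lt0n.
by apply/esym; apply: contraTneq iE => ->.
Qed.

Lemma big_fset_disjoint (V : nmodType) (A B : {fset nat}) (f : nat -> V) :
  (forall i, i \in A -> i \notin B) ->
  \sum_(i <- (A `|` B)%fset) f i = \sum_(i <- A) f i + \sum_(i <- B) f i.
Proof.
move=> AB; rewrite -big_cat; apply: perm_big; apply: uniq_perm.
- exact: fset_uniq.
- rewrite cat_uniq !fset_uniq/= andbT; apply/hasPn => i iB.
  by apply: contraTN iB => /AB.
- by move=> i; rewrite mem_cat inE.
Qed.

Section RealForms.
Variables (R : realType) (K : numFieldType) (F : real_coordinates R K).
Local Notation re := (rpart F).
Local Notation "r %:K" := (emb F r) (at level 2, format "r %:K").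
Local Notation abs := (abs F).
Local Notation N := (rnorm F).

Definition snorm (E : {fset nat}) (a : nat -> K) : R :=
  \big[Num.max/0]_(1 <= m < (\max_(i <- E) i).+1) abs (\sum_(i <- E | (i <= m)%N) a i).

Lemma summing_normE E a : summing_norm E a = (snorm E a)%:K.
Proof.
rewrite /summing_norm /snorm (@big_morph _ _ (emb F) 0 Num.max 0 Num.max).
- by apply: eq_bigr => m _; exact: absE.
- by move=> x y; rewrite /Order.max emb_lt; case: ifP.
- exact: rmorph0.
Qed.

Lemma snorm_le (E : {fset nat}) a (B : R) : 0 <= B ->
  (forall m, abs (\sum_(i <- E | (i <= m)%N) a i) <= B) -> snorm E a <= B.
Proof. by move=> B0 EB; apply: bigmax_le. Qed.

Lemma le_snorm (E : {fset nat}) a p : 0%N \notin E ->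
  abs (\sum_(i <- E | (i <= p)%N) a i) <= snorm E a.
Proof.
move=> E0; set M := \max_(i <- E) i.
have EM i : i \in E -> (i <= M)%N by move=> iE; exact: (@leq_bigmax_seq _ _ xpredT id).
have pmin : \sum_(i <- E | (i <= p)%N) a i = \sum_(i <- E | (i <= minn p M)%N) a i.
  rewrite big_seq_cond [RHS]big_seq_cond; apply: eq_bigl => i.
  by case iE : (i \in E) => //=; rewrite leq_min EM// andbT.
rewrite pmin; have [m0|m0] := posnP (minn p M).
  rewrite big_seq_cond big1 ?abs0; last first.
    by move=> i /andP[iE]; rewrite m0 leqn0 => /eqP i0; rewrite i0 (negPf E0) in iE.
  exact: bigmax_ge_id.
apply: (le_bigmax_seq _ (minn p M)) => //.
by rewrite mem_index_iota m0 ltnS geq_minr.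
Qed.

Lemma snorm_le_l1 E a : snorm E a <= \sum_(i <- E) abs (a i).
Proof.
apply: snorm_le => [|m]; first by apply: sumr_ge0 => i _; exact: abs_ge0.
apply: le_trans (abs_sum _ _ _ _) _; rewrite [leRHS](bigID (fun i => i <= m)%N)/= lerDl.
by apply: sumr_ge0 => i _; exact: abs_ge0.
Qed.

Section Sequences.
Variable X : normedModType K.
Implicit Types x : nat -> X.

Lemma seminormalizedP x : seminormalized x <->
  exists c C : R, [/\ 0 < c, 0 < C
    & forall n, (0 < n)%N -> c <= N (x n) /\ N (x n) <= C].
Proof.
split=> [[c [C [c0 C0 xP]]]|[c [C [c0 C0 xP]]]].
  have cE : (re c)%:K = c by rewrite embK// ltW.
  have CE : (re C)%:K = C by rewrite embK// ltW.
  exists (re c), (re C); rewrite -!(emb_lt F) rmorph0 cE CE; split=> // n /xP.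
  by rewrite -!(emb_le F) cE CE -rnormE.
exists c%:K, C%:K; rewrite -(rmorph0 (emb F)) !emb_lt; split=> // n /xP.
by rewrite (rnormE F) !emb_le.
Qed.

Lemma l1_spreading_modelP (G : set {fset nat}) x : l1_spreading_model G x <->
  exists a b : R, [/\ 0 < a, 0 < b & forall (E : {fset nat}) (c : nat -> K), G E ->
    \sum_(i <- E) abs (c i) <= a * N (\sum_(i <- E) c i *: x i) /\
    N (\sum_(i <- E) c i *: x i) <= b * \sum_(i <- E) abs (c i)].
Proof.
have sumE (E : {fset nat}) (c : nat -> K) : \sum_(i <- E) `|c i| = (\sum_(i <- E) abs (c i))%:K.
  by rewrite rmorph_sum; apply: eq_bigr => i _; exact: absE.
split=> [[a [b [a0 b0 xP]]]|[a [b [a0 b0 xP]]]].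
  have aE : (re a)%:K = a by rewrite embK// ltW.
  have bE : (re b)%:K = b by rewrite embK// ltW.
  exists (re a), (re b); rewrite -!(emb_lt F) rmorph0 aE bE; split=> // E c /(xP E c).
  by rewrite -!(emb_le F) !rmorphM aE bE -rnormE sumE.
exists a%:K, b%:K; split.
- by rewrite -(rmorph0 (emb F)) emb_lt.
- by rewrite -(rmorph0 (emb F)) emb_lt.
by move=> E c /(xP E c); rewrite (rnormE F) sumE -!rmorphM !emb_le.
Qed.

Lemma bounded_sequence_l1 (G : set {fset nat}) x (b : R) : (0 <= b) ->
  (forall E, G E -> 0%N \notin E) -> (forall n, (0 < n)%N -> N (x n) <= b) ->
  forall (E : {fset nat}) (c : nat -> K), G E ->
    N (\sum_(i <- E) c i *: x i) <= b * \sum_(i <- E) abs (c i).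
Proof.
move=> b0 G0 xb E c /G0 E0; apply: le_trans (rnorm_sum _ _ _ _) _.
rewrite mulr_sumr big_seq [leRHS]big_seq; apply: ler_sum => i iE.
rewrite rnormZ mulrC ler_wpM2r ?abs_ge0// xb// lt0n.
by apply: contraTneq iE => ->.
Qed.

End Sequences.

Section Operators.
Variables (X Y : normedModType K) (A : {linear X -> Y}).

Lemma bounded_operatorP : bounded_operator A ->
  exists2 M : R, 0 < M & forall x, N (A x) <= M * N x.
Proof.
move=> /linear_boundedP[M [Mr MP]]; have [r rM] := real_embP F Mr.
exists (`|r| + 1); first by rewrite ltr_wpDl.
move=> x; have /MP/(_ x) : M < (`|r| + 1)%:K.
  by rewrite rM emb_lt; have := ler_norm r; lra.
by rewrite !(rnormE F) -rmorphM emb_le.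
Qed.

Lemma S_weakly_compactP (G : set {fset nat}) : S_weakly_compact G A <->
  forall x : nat -> X, seminormalized x -> basic_sequence x ->
  forall e : R, 0 < e -> exists (E : {fset nat}) (a : nat -> K), G E /\
    N (\sum_(i <- E) a i *: A (x i)) < e * snorm E a.
Proof.
split=> GA x xs xb e e0.
  have [|E [a [GE]]] := GA x xs xb e%:K; first by rewrite -(rmorph0 (emb F)) emb_lt.
  by rewrite summing_normE (rnormE F) -rmorphM emb_lt => h; exists E, a.
have eE : (re e)%:K = e by rewrite embK// ltW.
have [|E [a [GE]]] := GA x xs xb (re e); first by rewrite -(emb_lt F) rmorph0 eE.
by rewrite -(emb_lt F) rmorphM eE -rnormE -summing_normE => h; exists E, a.
Qed.

End Operators.

(** * S-weakly compact operators are weakly compact *)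

Lemma filter_seq (T : Type) (J : eqType) (V : set_system T) (Q : J -> set T) (s : seq J) :
  Filter V -> (forall j, j \in s -> V (Q j)) ->
  V [set x | forall j, j \in s -> Q j x].
Proof.
move=> FV; elim: s => [|j s IH] VQ; first by apply: filterS filterT.
have Vj := VQ j (mem_head _ _).
apply: filterS (filterI Vj (IH _)) => [x [Qx sx] i|i si].
  by rewrite inE => /predU1P[->|/sx].
by apply: VQ; rewrite inE si orbT.
Qed.

Section FarSelection.
Variables (Z : normedModType K) (zs : (Z -> K) -> K) (kappa : R) (u : nat -> Z).
Let z l (g : Z -> K) := if l is 0 then zs g else g (u l) - zs g.

(** In the bidual, a combination of the [u i] is also a combination of [zs] and the
    [u i - zs]; its [k]-th partial sum is an element of [Z] plus the [k]-th tail of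
    the coefficients times [zs]. *)
Lemma far_selection :
  0 < kappa ->
  (forall k g, functional F 1 g -> exists j, [/\ functional F 1 j,
     forall l, (l <= k)%N -> abs (z l g - z l j) <= kappa / 8 / k.+1%:R
   & forall l, (k < l)%N -> abs (z l j) <= kappa / 8 * 2^-1 ^+ l.+1]) ->
  (forall v, exists2 g, functional F 1 g & kappa <= abs (g v - zs g)) ->
  forall n (a : nat -> K) k, (k <= n)%N ->
  kappa * abs (\sum_(k.+1 <= i < n.+1) a i) <= 2 * N (partial_sum u a n) /\
  forall g, functional F 1 g ->
    abs (g (partial_sum u a k) + (\sum_(k.+1 <= i < n.+1) a i) * zs g) <=
    2 * N (partial_sum u a n).
Proof.
move=> k0 znet zfar n a k kn.
pose b i := if i is 0 then \sum_(1 <= l < n.+1) a l else a i.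
have zlow l : exists2 g, functional F 1 g & kappa <= abs (z l g).
  case: l => [|l]; last exact: zfar.
  by have [g g1 kg] := zfar 0; exists g => //; rewrite -absN -sub0r -(functional0 g1).
have sumE m g : functional F 1 g -> (m <= n)%N ->
    \sum_(0 <= l < m.+1) b l * z l g =
    g (partial_sum u a m) + (\sum_(m.+1 <= i < n.+1) a i) * zs g.
  move=> g1 mn; rewrite big_ltn//= (@big_cat_nat _ _ _ m.+1 1 n.+1)//=.
  rewrite /partial_sum (functional_sum g1) mulrDl addrAC; congr (_ + _).
  rewrite mulr_suml -big_split/= big_nat [RHS]big_nat.
  apply: eq_bigr => -[|l] // _; rewrite /b /z (functionalZ g1); ring.
have uB g : functional F 1 g ->
    abs (\sum_(0 <= l < n.+1) b l * z l g) <= N (partial_sum u a n).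
  move=> g1; rewrite sumE// [\sum_(n.+1 <= i < n.+1) _]big_geq// mul0r addr0.
  by have := g1.2 (partial_sum u a n); rewrite mul1r.
have [_ bound] := mazur_inequality k0 znet zlow uB.
have {bound}bound g : functional F 1 g ->
  abs (g (partial_sum u a k) + (\sum_(k.+1 <= i < n.+1) a i) * zs g) <=
    2 * N (partial_sum u a n).
  by move=> g1; rewrite -sumE//; exact: bound.
split=> //; set s := \sum_(k.+1 <= i < n.+1) a i in bound *.
have [->|s0] := eqVneq s 0; first by rewrite abs0 mulr0 mulr_ge0// rnorm_ge0.
have [g g1 kg] := zfar (- s^-1 *: partial_sum u a k).
apply: le_trans (bound g g1).
have -> : g (partial_sum u a k) + s * zs g =
    - s * (g (- s^-1 *: partial_sum u a k) - zs g).
  by rewrite (functionalZ g1); field.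
by rewrite absM absN mulrC ler_wpM2l// abs_ge0.
Qed.

End FarSelection.

Lemma complete_limit (Y : completeNormedModType K) (y : nat -> Y) :
  (forall n m, N (y n - y m) <= n.+1%:R^-1 + m.+1%:R^-1) ->
  exists l, forall e : R, 0 < e -> exists n0, forall n, (n0 <= n)%N -> N (l - y n) < e.
Proof.
move=> yc; suff : cvg (y @ \oo).
  by move=> yl; exists (lim (y @ \oo)); exact/(seq_cvgP F).
apply/cauchy_cvgP/cauchy_exP => e e0.
have re0 : 0 < re e by rewrite -(emb_lt F) embK ?rmorph0// ltW.
have p0 : 0 <= 2 / re e by rewrite divr_ge0// ltW.
pose k := Num.trunc (2 / re e).
have ke : 2 * k.+1%:R^-1 < re e.
  have /andP[_] := truncn_itv p0; rewrite -/k ltr_pdivrMr// => ke.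
  by rewrite ltr_pdivrMr ?ltr0Sn// mulrC.
exists (y k), k => // n /= kn; rewrite -ball_normE/= (rnormE F) -[e](embK F) ?ltW//.
rewrite emb_lt; apply: le_lt_trans (yc k n) _.
have : (n.+1%:R^-1 : R) <= k.+1%:R^-1 by rewrite lef_pV2 ?posrE// ler_nat ltnS.
by move: (n.+1%:R^-1) ke; move: (k.+1%:R^-1) => ik il; lra.
Qed.

Section NotWeaklyCompact.
Variables (X : normedModType K) (Y : completeNormedModType K) (A : {linear X -> Y}).

(** A functional on the dual that is not evaluation at a vector lies at positive
    distance from the space, because the space is closed in its bidual. *)
Lemma far_from_space (ys : (Y -> K) -> K) :
  ~ (exists y, forall f, functional F 1 f -> ys f = f y) ->
  exists2 theta : R, 0 < theta &
    forall y, exists2 f, functional F 1 f & theta <= abs (f y - ys f).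
Proof.
move=> far; apply: contrapT => near; apply: far.
have /choice[y yP] n : exists y, forall f, functional F 1 f ->
    abs (f y - ys f) < n.+1%:R^-1.
  apply: contrapT => ny; apply: near; exists (n.+1%:R^-1); first by rewrite invr_gt0.
  move=> y; apply: contrapT => nf; apply: ny; exists y => f f1.
  by rewrite ltNge; apply/negP => fy; apply: nf; exists f.
have [|l lP] := @complete_limit _ y.
  move=> n m; have [f f1 fE] := norming_functional F (y n - y m).
  have := absB F (f (y n) - ys f) (f (y m) - ys f).
  rewrite opprB addrA subrK -(functionalB f1) fE abs_emb ?rnorm_ge0//.
  have := yP n f f1; have := yP m f f1.
  by move: (n.+1%:R^-1) (m.+1%:R^-1) => p q; lra.
exists l => f f1; apply/esym/eqP; rewrite -subr_eq0; apply/eqP/(@abs_eq0 _ _ F)/eqP.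
rewrite eq_le abs_ge0 andbT; apply/ler_addgt0Pr => e; rewrite add0r.
move: e => e e0; have e20 : 0 < e / 2 by rewrite divr_gt0.
have [n0 n0P] := lP _ e20.
have p0 : 0 <= 2 / e by rewrite divr_ge0// ltW.
pose k := maxn n0 (Num.trunc (2 / e)).
have ke : k.+1%:R^-1 < e / 2.
  have /andP[_ h] := truncn_itv p0.
  rewrite -[e / 2]invrK invf_div ltf_pV2 ?posrE ?divr_gt0//.
  by apply: lt_le_trans h _; rewrite ler_nat ltnS leq_maxr.
have := n0P k (leq_maxl _ _); have := f1.2 (l - y k); rewrite mul1r (functionalB f1).
have := absD F (f l - f (y k)) (f (y k) - ys f); rewrite addrA subrK.
by have := lt_trans (yP k f f1) ke; lra.
Qed.

(** The distance from [xs] to [X] bounds the tails of the coefficients, hence the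
    partial sum projections of [x]. The distance from [ys] to [Y] bounds the tails
    by the norm in [Y], and an initial sum is the difference of two tails. *)
Lemma not_weakly_compact_sequence :
  bounded_operator A -> ~ weakly_compact A ->
  exists x : nat -> X, [/\ seminormalized x, basic_sequence x &
    exists2 delta : R, 0 < delta & forall n (a : nat -> K) m, (m <= n)%N ->
      delta * abs (\sum_(1 <= i < m.+1) a i) <=
      N (partial_sum (fun i => A (x i)) a n)].
Proof.
move=> /bounded_operatorP[M M0 AM] nwc.
have [V [UV V1 Vy]] := not_weakly_compact_ultrafilter F nwc.
have {}V1 : V [set x | N x <= 1].
  apply: filterS V1 => x /=; by rewrite (rnormE F) -(rmorph1 (emb F)) emb_le.
pose xs (g : X -> K) := ulim F V g.
pose ys (f : Y -> K) := ulim F V (fun x => f (A x)).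
have gb g x : functional F 1 g -> abs (g x) <= N x.
  by move=> g1; have := g1.2 x; rewrite mul1r.
have fb f x : functional F 1 f -> abs (f (A x)) <= M * N x.
  by move=> f1; have := f1.2 (A x); rewrite mul1r => /le_trans; exact.
have gV g : functional F 1 g -> V [set x | abs (g x) <= 1].
  by move=> g1; apply: filterS V1 => x /=; apply: le_trans; exact: gb.
have fV f : functional F 1 f -> V [set x | abs (f (A x)) <= M].
  move=> f1; apply: filterS V1 => x /= x1; apply: le_trans (fb f x f1) _.
  by rewrite ler_piMr// ltW.
have xsP g : functional F 1 g -> tends F V g (xs g) by move=> /gV; exact: ulimP.
have ysP f : functional F 1 f -> tends F V (fun x => f (A x)) (ys f).
  by move=> /fV; exact: ulimP.
have xs1 g (g1 : functional F 1 g) : abs (xs g) <= 1 := tends_le (xsP g g1) (gV g g1).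
have ysM f (f1 : functional F 1 f) : abs (ys f) <= M := tends_le (ysP f f1) (fV f f1).
have [|theta theta0 yfar] := @far_from_space ys.
  move=> [y yP]; apply: (Vy y) => D; have [C C0 DC] := dual_functional F D.
  have C10 : C + 1 != 0 by rewrite gt_eqF//; lra.
  have C1E : (C + 1)%:K != 0 by rewrite fmorph_eq0.
  pose f v := ((C + 1)^-1)%:K * sval D v.
  have f1 : functional F 1 f.
    split=> [a v w|v]; first by rewrite /f DC.1; ring.
    rewrite /f absM abs_emb ?invr_ge0; last by lra.
    rewrite mulrC ler_pdivrMr; last by lra.
    rewrite mul1r mulrC; apply: le_trans (DC.2 v) _.
    by rewrite ler_wpM2r ?rnorm_ge0//; lra.
  have FV : Filter V by exact: filter_filter.
  have := @tendsZ _ _ _ _ V FV _ (C + 1)%:K _ (ysP f f1).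
  rewrite (yP f f1) /f fmorphV mulrA mulfV// mul1r.
  move=> h; apply: tends_near h; apply: filterS filterT => x _ /=.
  by rewrite mulrA mulfV// mul1r.
have xfar x : exists2 g, functional F 1 g & theta / M <= abs (g x - xs g).
  have [f f1 thf] := yfar (A x).
  pose g v := (M^-1)%:K * f (A v).
  have g1 : functional F 1 g.
    split=> [a v w|v]; first by rewrite /g linearP f1.1; ring.
    rewrite /g absM abs_emb ?invr_ge0 ?(ltW M0)// mulrC ler_pdivrMr// mul1r mulrC.
    exact: fb.
  exists g => //.
  have -> : xs g = (M^-1)%:K * ys f.
    exact: tends_unique (xsP g g1) (tendsZ (M^-1)%:K (ysP f f1)).
  rewrite /g -mulrBr absM abs_emb ?invr_ge0 ?(ltW M0)//.
  by rewrite mulrC ler_wpM2l// invr_ge0 ltW.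
pose kappa := Num.min theta (theta / M).
have kappa0 : 0 < kappa by rewrite lt_min theta0 divr_gt0.
(* The index None stands for xs and ys, the index Some x for x - xs and A x - ys. *)
pose I := ((X -> K) + (Y -> K))%type.
pose P (b : bool) : set I := if b then [set i | exists2 g, functional F 1 g & i = inl g]
  else [set i | exists2 f, functional F 1 f & i = inr f].
pose ev (o : option X) (i : I) : K := match o, i with
  | None, inl g => xs g | None, inr f => ys f
  | Some x, inl g => g x - xs g | Some x, inr f => f (A x) - ys f end.
pose ok (h : seq (option X)) (o : option X) := exists2 x, o = Some x & N x <= 1.
have [|||r [r0 rok rnet]] := @mazur_selection _ _ F I P (option X) ev ok (kappa / 8) None.
- by rewrite divr_gt0.
- move=> [x|] [].
  + exists (N x + 1) => _ [g g1 ->] /=; apply: le_trans (absB _ _ _) _.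
    by rewrite lerD ?gb ?xs1.
  + exists (M * N x + M) => _ [f f1 ->] /=; apply: le_trans (absB _ _ _) _.
    by rewrite lerD ?fb ?ysM.
  + by exists 1 => _ [g g1 ->]; exact: xs1.
  + by exists M => _ [f f1 ->]; exact: ysM.
- move=> h s e e0 sP.
  have Vs : V [set x | forall i, i \in s -> abs (ev (Some x) i) <= e].
    apply: filter_seq => i /sP[[] [g g1 ->]] /=.
      by apply: filterS (xsP g g1 e e0) => x /=; exact: ltW.
    by apply: filterS (ysP g g1 e e0) => x /=; exact: ltW.
  have [x [/= x1 xP]] := filter_ex (filterI V1 Vs).
  by exists (Some x); split=> //; exists x.
pose x i := odflt 0 (r i).
have rx i : r i.+1 = Some (x i.+1) by rewrite /x; case: (rok i) => y ->.
have x1 i : (0 < i)%N -> N (x i) <= 1.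
  by case: i => // i _; have [y ry y1] := rok i; rewrite /x ry.
have kx v : exists2 g, functional F 1 g & kappa <= abs (g v - xs g).
  have [g g1 h] := xfar v; exists g => //; apply: le_trans h.
  by rewrite ge_min lexx orbT.
have ky v : exists2 g, functional F 1 g & kappa <= abs (g v - ys g).
  have [g g1 h] := yfar v; exists g => //; apply: le_trans h.
  by rewrite ge_min lexx.
pose zx l (g : X -> K) := if l is 0 then xs g else g (x l) - xs g.
pose zy l (f : Y -> K) := if l is 0 then ys f else f (A (x l)) - ys f.
have xnet k g : functional F 1 g -> exists j, [/\ functional F 1 j,
    forall l, (l <= k)%N -> abs (zx l g - zx l j) <= kappa / 8 / k.+1%:R
  & forall l, (k < l)%N -> abs (zx l j) <= kappa / 8 * 2^-1 ^+ l.+1].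
  move=> g1; have [|_ [[j j1 ->] jle jgt]] := rnet true k (inl g); first by exists g.
  by exists j; split=> // -[|l]; [move=> /jle|move=> /jle|move=> /jgt|move=> /jgt];
    rewrite ?r0 ?rx.
have ynet k f : functional F 1 f -> exists j, [/\ functional F 1 j,
    forall l, (l <= k)%N -> abs (zy l f - zy l j) <= kappa / 8 / k.+1%:R
  & forall l, (k < l)%N -> abs (zy l j) <= kappa / 8 * 2^-1 ^+ l.+1].
  move=> f1; have [|_ [[j j1 ->] jle jgt]] := rnet false k (inr f); first by exists f.
  by exists j; split=> // -[|l]; [move=> /jle|move=> /jle|move=> /jgt|move=> /jgt];
    rewrite ?r0 ?rx.
have xsel := far_selection kappa0 xnet kx.
have ysel n a k (kn : (k <= n)%N) := (far_selection kappa0 ynet ky a kn).1.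
have xlow i : (0 < i)%N -> kappa / 2 <= N (x i).
  case: i => // i _.
  have := (xsel i.+1 (fun j => (j == i.+1)%:R) i (leqnSn i)).1.
  rewrite big_nat1 eqxx abs1 mulr1 partial_sumS eqxx scale1r.
  suff -> : partial_sum x (fun j => (j == i.+1)%:R) i = 0 by rewrite add0r; lra.
  rewrite /partial_sum big_nat big1// => j /andP[_ ji].
  by rewrite (ltn_eqF ji) scale0r.
exists x; split.
- apply/seminormalizedP; exists (kappa / 2), 1; split=> //; first by rewrite divr_gt0.
  by move=> n n0; split; [exact: xlow|exact: x1].
- apply: (@basic_criterion _ _ F _ x (2 + 2 / kappa) (kappa / 2)).
  + by rewrite divr_gt0.
  + by rewrite addr_ge0// divr_ge0// ltW.
  + exact: xlow.
  move=> a m n mn; have [ks kg] := xsel n a m mn.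
  have [g g1 gE] := norming_functional F (partial_sum x a m).
  have := kg g g1; set s := \sum_(m.+1 <= i < n.+1) a i in ks *.
  have := absB F (g (partial_sum x a m) + s * xs g) (s * xs g).
  rewrite addrK gE abs_emb ?rnorm_ge0//.
  have : abs (s * xs g) <= abs s by rewrite absM ler_piMr ?abs_ge0// xs1.
  have : abs s <= 2 / kappa * N (partial_sum x a n).
    by rewrite mulrAC ler_pdivlMr// mulrC.
  lra.
- exists (kappa / 4); first by rewrite divr_gt0.
  move=> n a m mn; have h0 := ysel n a 0%N (leq0n n); have hm := ysel n a m mn.
  rewrite (@big_cat_nat _ _ _ m.+1)//= in h0.
  set s := \sum_(1 <= i < m.+1) a i in h0 *.
  set t := \sum_(m.+1 <= i < n.+1) a i in h0 hm.
  have : kappa * abs s <= kappa * (abs (s + t) + abs t).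
    by rewrite ler_wpM2l ?(ltW kappa0)//; have := absB F (s + t) t; rewrite addrK.
  lra.
Qed.

End NotWeaklyCompact.

Lemma S_weakly_compact_weakly_compact (X : normedModType K) (Y : completeNormedModType K)
    (A : {linear X -> Y}) (G : set {fset nat}) :
  (forall E, G E -> 0%N \notin E) -> bounded_operator A ->
  S_weakly_compact G A -> weakly_compact A.
Proof.
move=> G0 Ab /S_weakly_compactP GA; apply: contrapT => /(not_weakly_compact_sequence Ab).
move=> [x [xs xb [delta delta0 xP]]].
have [E [a [GE]]] := GA x xs xb delta delta0.
apply/negP; rewrite -leNgt mulrC -ler_pdivlMr//; have E0 := G0 _ GE.
apply: snorm_le => [|m]; first by rewrite divr_ge0 ?rnorm_ge0// ltW.
pose n := maxn m (\max_(i <- E) i).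
pose b i := if i \in E then a i else 0.
have En i : i \in E -> (i <= n)%N.
  by move=> iE; rewrite leq_max (@leq_bigmax_seq _ _ xpredT id) ?orbT.
have := xP n b m (leq_maxl _ _); rewrite ler_pdivlMr// mulrC.
have -> : \sum_(1 <= i < m.+1) b i = \sum_(i <- E | (i <= m)%N) a i.
  rewrite [RHS]big_mkcond (big_fset_nat _ E0 En).
  rewrite [RHS](@big_cat_nat _ _ _ m.+1)//= ?ltnS ?leq_maxl//.
  rewrite [X in _ = _ + X]big_nat_cond [X in _ = _ + X]big1 ?addr0; last first.
    by move=> i /andP[/andP[mi _] _]; rewrite leqNgt mi.
  rewrite [RHS]big_mkcond !big_nat; apply: eq_bigr => i /andP[_]; rewrite ltnS => im.
  by rewrite /b im.
have -> // : partial_sum (fun i => A (x i)) b n = \sum_(i <- E) a i *: A (x i).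
rewrite (big_fset_nat _ E0 En) [RHS]big_mkcond; apply: eq_bigr => i _.
by rewrite /b; case: ifP => // _; rewrite scale0r.
Qed.

End RealForms.

(** * Differences of an l1 spreading model *)

Section Differences.
Variables (R : realType) (K : numFieldType) (F : real_coordinates R K).
Local Notation abs := (abs F).
Local Notation N := (rnorm F).

Lemma pigeonhole (T : finType) (c : nat -> T) (m : nat) :
  exists i j, [/\ (m <= i)%N, (i < j)%N & c i = c j].
Proof.
pose f (k : 'I_#|T|.+1) := c (m + k)%N.
have /injectivePn[i [j ij fij]] : ~~ injectiveb f.
  by apply/negP => /injectiveP/leq_card; rewrite card_ord ltnn.
wlog lt_ij : i j ij fij / (i < j)%N => [H|].
  case: (ltngtP i j) => [|ji|eij]; first exact: H.
    by apply: (H j i) => //; rewrite eq_sym.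
  by move: ij; rewrite (val_inj eij) eqxx.
by exists (m + i)%N, (m + j)%N; rewrite leq_addr ltn_add2l lt_ij.
Qed.

Section Sequences.
Variables (X : normedModType K) (G : set {fset nat}) (x : nat -> X) (a b : R).
Hypotheses (rG : regular G) (a0 : 0 < a) (b0 : 0 < b).
Hypothesis pairsG : forall n m, (1 < n)%N -> (n < m)%N -> G [fset n; m]%fset.
Hypothesis lower : forall (E : {fset nat}) (c : nat -> K), G E ->
  \sum_(i <- E) abs (c i) <= a * N (\sum_(i <- E) c i *: x i).
Hypothesis upper : forall (E : {fset nat}) (c : nat -> K), G E ->
  N (\sum_(i <- E) c i *: x i) <= b * \sum_(i <- E) abs (c i).

Lemma term_upper n : (0 < n)%N -> N (x n) <= b.
Proof.
move=> n0; have := upper (fun=> 1) (singletons rG n0).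
by rewrite !big_seq_fset1 scale1r abs1 mulr1.
Qed.

Lemma difference_lower n m : (1 < n)%N -> (n < m)%N -> 2 / a <= N (x n - x m).
Proof.
move=> n1 nm; have := lower (fun i => if i == n then 1 else -1) (pairsG n1 nm).
have nm' : n \notin [fset m]%fset by rewrite inE ltn_eqF.
rewrite !big_fsetU1//= !big_seq_fset1 eqxx gtn_eqF// absN abs1 scale1r scaleN1r.
by rewrite ler_pdivrMr// mulrC.
Qed.

(** By the pigeonhole principle finitely many functionals nearly agree at some two
    late terms of a bounded sequence, so the difference of these terms is nearly
    annihilated by the functionals. *)
Lemma difference_sequence : exists p q : nat -> nat,
  [/\ forall k, (k.*2 <= p k)%N, forall k, (p k < q k)%N,
      forall k, (q k < p k.+1)%N,
      seminormalized (fun k => x (p k) - x (q k))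
    & basic_sequence (fun k => x (p k) - x (q k))].
Proof.
pose ev (d : nat * nat) (g : X -> K) := g (x d.1) - g (x d.2).
pose P (_ : bool) : set (X -> K) := [set g | functional F 1 g].
pose ok (h : seq (nat * nat)) d := ((last (2, 3) h).2 < d.1)%N /\ (d.1 < d.2)%N.
pose kappa := 2 / a.
have kappa0 : 0 < kappa by rewrite divr_gt0.
have gb g v : functional F 1 g -> abs (g v) <= N v.
  by move=> g1; have := g1.2 v; rewrite mul1r.
have [|||r [r0 rok rnet]] := @mazur_selection _ _ F _ P _ ev ok (kappa / 8) (2, 3)%N.
- by rewrite divr_gt0.
- move=> d b1; exists (N (x d.1) + N (x d.2)) => g g1; apply: le_trans (absB _ _ _) _.
  by rewrite lerD ?gb.
- move=> h s e e0 sP.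
  pose z j n := nth (fun=> 0) s j (x n).
  have [|T [c cP]] := @finite_cells _ _ F nat [set n | (0 < n)%N] (size s) z e e0.
    move=> j js; exists b => n n0.
    have [b1 g1] := sP _ (mem_nth (fun=> 0) js).
    have zb : abs (z j n) <= N (x n) by exact: gb g1.
    apply: le_trans zb _; exact: term_upper.
  have [n [m [hn nm cnm]]] := pigeonhole c (last (2, 3)%N h).2.+1.
  exists (n, m); split; first by split.
  move=> g /[dup] gs; rewrite -index_mem => gi.
  have n0 : (0 < n)%N by exact: leq_trans hn.
  have := cP n m n0 (ltn_trans n0 nm) cnm _ gi.
  by rewrite /z nth_index.
pose p k := (r k).1; pose q k := (r k).2; exists p, q.
have last_r k : last (2, 3)%N (mkseq r k.+1) = r k by rewrite mkseqS last_rcons.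
have pq k : (p k < q k)%N.
  by case: k => [|k]; [rewrite /p /q r0|case: (rok k)].
have qp k : (q k < p k.+1)%N by have [] := rok k; rewrite last_r.
have p2 k : (k.*2.+2 <= p k)%N.
  elim: k => [|k IH]; first by rewrite /p r0.
  rewrite doubleS; apply: leq_ltn_trans (qp k).
  exact: leq_ltn_trans IH (pq k).
have zlow k : kappa <= N (x (p k) - x (q k)).
  by apply: difference_lower => //; apply: leq_trans (p2 k).
have zbasic m n (c : nat -> K) : (m <= n)%N ->
    N (partial_sum (fun k => x (p k) - x (q k)) c m) <=
    2 * N (partial_sum (fun k => x (p k) - x (q k)) c n).
  move=> mn; set z := fun k => _.
  pose d i := if i is 0 then 0 else c i.
  have sumE k g : functional F 1 g ->
      \sum_(0 <= l < k.+1) d l * ev (r l) g = g (partial_sum z c k).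
    move=> g1; rewrite big_ltn//= mul0r add0r /partial_sum (functional_sum g1).
    rewrite !big_nat; apply: eq_bigr => -[|l] // _.
    by rewrite (functionalZ g1) (functionalB g1).
  have zl l : exists2 g, P true g & kappa <= abs (ev (r l) g).
    have [g g1 gE] := norming_functional F (x (p l) - x (q l)).
    exists g; first exact: g1.
    by rewrite /ev -(functionalB g1) gE abs_emb ?rnorm_ge0.
  have zn g : P true g ->
      abs (\sum_(0 <= l < n.+1) d l * ev (r l) g) <= N (partial_sum z c n).
    by move=> g1; rewrite sumE// gb.
  have [_ zk] := mazur_inequality kappa0 (rnet true) zl zn.
  have [g g1 gE] := norming_functional F (partial_sum z c m).
  by have := zk m g mn g1; rewrite sumE// gE abs_emb// rnorm_ge0.
split=> //.
- by move=> k; apply: leq_trans (p2 k); rewrite ltnW.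
- apply/(seminormalizedP F); exists kappa, (b + b); split; rewrite ?addr_gt0//.
  move=> k _; split; first exact: zlow.
  apply: le_trans (rnormB _ _ _) _; apply: lerD; apply: term_upper.
    exact: leq_trans (p2 k).
  by apply: leq_trans (pq k).
- by apply: (@basic_criterion _ _ F _ _ 2 kappa) => // c m n; exact: zbasic.
Qed.

End Sequences.

(** [doubling] keeps the supports of sums of differences in the family, and the l1
    norm dominates the norm of the summing basis. *)
Lemma S_weakly_compact_no_l1 (X Y : normedModType K) (A : {linear X -> Y})
    (G : set {fset nat}) :
  regular G -> doubling G ->
  (forall n m, (1 < n)%N -> (n < m)%N -> G [fset n; m]%fset) ->
  S_weakly_compact G A -> forall x : nat -> X, l1_spreading_model G x ->
  ~ l1_spreading_model G (fun n => A (x n)).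
Proof.
move=> rG dG pG /(S_weakly_compactP F) GA x /(l1_spreading_modelP F)[a [b [a0 b0 xab]]].
move=> /(l1_spreading_modelP F)[a' [b' [a'0 b'0 Axab]]].
have [p [q [p2 pq qp zs zb]]] := difference_sequence rG a0 b0 pG
  (fun E c GE => (xab E c GE).1) (fun E c GE => (xab E c GE).2).
have a'V0 : 0 < a'^-1 by rewrite invr_gt0.
have [E [c [GE]]] := GA _ zs zb _ a'V0.
set z := \sum_(i <- E) _ => zlt.
have pmono i j : (i < j)%N -> (p i < p j)%N.
  by move=> ij; apply: ltn_trans (pq i) _; exact: interlaced_lt_step.
have qmono i j : (i < j)%N -> (q i < q j)%N.
  by move=> ij; apply: ltn_trans _ (pq j); exact: interlaced_lt_step.
have mono_inj f : (forall i j, (i < j)%N -> (f i < f j)%N) -> injective f.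
  move=> fm i j fij; case: (ltngtP i j) => // /fm; by rewrite fij ltnn.
have pinj := mono_inj p pmono; have qinj := mono_inj q qmono.
have pqneq i j : p i <> q j.
  case: (ltngtP i j) => [/pmono ij|/(interlaced_lt_step pq qp)|->] h.
  - by have := pq j; rewrite -h => /ltn_trans/(_ ij); rewrite ltnn.
  - by move: h => /[swap] ->; rewrite ltnn.
  - by have := pq j; rewrite h ltnn.
have /choice[d dP] j : exists v : K, forall k, (j = p k -> v = c k) /\ (j = q k -> v = - c k).
  have [[k ->]|np] := pselect (exists k, j = p k).
    by exists (c k) => l; split=> [/pinj->//|/pqneq].
  have [[k ->]|nq] := pselect (exists k, j = q k).
    by exists (- c k) => l; split=> [/esym/pqneq//|/qinj->].
  by exists 0 => k; split=> jk; exfalso; [apply: np|apply: nq]; exists k.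
have dp k : d (p k) = c k by exact: (dP _ k).1.
have dq k : d (q k) = - c k by exact: (dP _ k).2.
have [+ _] := Axab _ d (dG E p q p2 pq qp GE).
have disj i : i \in [fset p k | k in E]%fset -> i \notin [fset q k | k in E]%fset.
  by move=> /imfsetP[k _ ->]; apply/negP => /imfsetP[l _ /pqneq].
rewrite !big_fset_disjoint//.
rewrite !big_imfset/=; try by move=> i j _ _; first [exact: pinj|exact: qinj].
rewrite -!big_split/=.
have -> : \sum_(i <- E) (d (p i) *: A (x (p i)) + d (q i) *: A (x (q i))) = z.
  apply: eq_bigr => i _; by rewrite dp dq linearB scalerBr scaleNr.
rewrite (eq_bigr (fun i => abs (c i) + abs (c i))); last first.
  by move=> i _; rewrite dp dq absN.
rewrite big_split/=.
have := lt_le_trans zlt (_ : _ <= a'^-1 * \sum_(i <- E) abs (c i)).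
rewrite ler_wpM2l ?snorm_le_l1 ?(ltW a'V0)// => /(_ isT).
rewrite mulrC ltr_pdivlMr// mulrC.
have : 0 <= \sum_(i <- E) abs (c i) by apply: sumr_ge0 => i _; exact: abs_ge0.
lra.
Qed.

End Differences.

(** * A tree of functionals *)

Section Tree.
Variables (R : realType) (K : numFieldType) (F : real_coordinates R K).
Local Notation re := (rpart F).
Local Notation "r %:K" := (emb F r) (at level 2, format "r %:K").
Local Notation abs := (abs F).
Local Notation N := (rnorm F).

Variables (S Ones : set {fset nat}) (rS : regular S).
Implicit Types s t E : {fset nat}.

Definition upto E i : {fset nat} := [fset j in E | (j <= i)%N]%fset.

Lemma in_upto E i j : (j \in upto E i) = (j \in E) && (j <= i)%N.
Proof. by rewrite !inE. Qed.

Hypothesis Ones_upto : forall E i, Ones E -> Ones (upto E i).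

(** The label of an element depends only on the part of the node up to it, so it
    does not change when the node is extended. *)
Definition label E i : K := if `[< Ones (upto E i) >] then 1 else 0.

Definition extends_by s n := (forall i, i \in s -> (i < n)%N) /\ S (n |` s)%fset.

(** By spreading, a node that can be extended can be extended by every larger
    integer. *)
Lemma extends_by_leq s n m : extends_by s n -> (n <= m)%N -> extends_by s m.
Proof.
move=> [sn Sn] nm; split=> [i /sn/leq_trans|]; first exact.
have := @spreading _ rS _ (fun i => if i == n then m else i) _ _ Sn.
rewrite imfsetU1 eqxx.
have -> : [fset (if i == n then m else i) | i in s]%fset = s.
  apply/fsetP => j; apply/imfsetP/idP => [[i /= si ->]|sj].
    by rewrite ltn_eqF// sn.
  by exists j; rewrite //= ltn_eqF// sn.
apply.
  move=> i j; rewrite !inE => /predU1P[->|si] /predU1P[->|sj]; rewrite ?ltnn ?eqxx//.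
  - by move=> nj; have := sn j sj; lia.
  - by move=> _; rewrite ltn_eqF ?sn//; apply: leq_trans nm; exact: sn.
  - by rewrite !ltn_eqF ?sn.
by move=> i; rewrite !inE => /predU1P[->|si]; [rewrite eqxx|rewrite ltn_eqF ?sn].
Qed.

Lemma label_extend s n i : (forall j, j \in s -> (j < n)%N) -> i \in s ->
  label (n |` s)%fset i = label s i.
Proof.
move=> sn si; rewrite /label.
suff -> : upto (n |` s)%fset i = upto s i by [].
have ni : (n <= i)%N = false by apply/negbTE; rewrite -ltnNge sn.
by apply/fsetP => j; rewrite !in_upto !inE; case: (eqVneq j n) => [->|//]; rewrite ni !andbF.
Qed.

Definition child t s := exists n, t = (n |` s)%fset /\ extends_by s n.

Lemma child_wf : well_founded child.
Proof.
move=> s0; apply: contrapT => nA.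
have /choice[g gP] s : exists n, ~ Acc child s ->
    extends_by s n /\ ~ Acc child (n |` s)%fset.
  have [As|nAs] := pselect (Acc child s); first by exists 0%N.
  apply: contrapT => nn; apply: nAs; split=> _ [n [-> sn]].
  by apply: contrapT => nAn; apply: nn; exists n.
pose s_ := fix s_ k := if k is k'.+1 then (g (s_ k') |` s_ k')%fset else s0.
have nAk k : ~ Acc child (s_ k) by elim: k => //= k /gP[].
pose L k := g (s_ k).
have Lk k : L k \in s_ k.+1 by rewrite /= !inE eqxx.
have Lmono : {homo L : i j / (i < j)%N}.
  apply: homo_ltn; first exact: ltn_trans.
  by move=> k; have [[h _] _] := gP _ (nAk k.+1); exact: h.
have [k kL] := no_infinite_branch rS Lmono.
apply: kL; have [[_ Sk] _] := gP _ (nAk k); apply: (hereditary rS _ Sk).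
apply/fsubsetP => x xk; apply/fsetUP; right; move: xk => /initialP[i ik ->].
elim: k ik {Sk} => // k IH; rewrite ltnS leq_eqVlt => /predU1P[->|/IH ik]; first exact: Lk.
by rewrite /= !inE ik orbT.
Qed.

Section Functionals.
Variables (Y : normedModType K) (u : nat -> Y) (y : Y) (C : R).
Variables (V : set_system nat) (UV : UltraFilter V).
Hypothesis V_infinite : forall n, V [set m | (n <= m)%N].
Hypothesis C0 : 0 <= C.
Hypothesis summing : forall E (a : nat -> K) p, S E ->
  abs (\sum_(i <- E | (i <= p)%N) a i) <= C * N (\sum_(i <- E) a i *: u i).
Hypothesis weak_limit : forall f, functional F C f ->
  tends F V (fun n => f (u n)) (f y).

Lemma functional_zero : functional F C (fun _ : Y => 0).
Proof.
by split=> [a v w|v]; rewrite ?mulr0 ?addr0// abs0 mulr_ge0// rnorm_ge0.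
Qed.

(** The labels form an initial segment of [E], so the prescribed values are
    partial sums. *)
Lemma leaf_functional E : S E ->
  exists f, functional F C f /\ forall i, i \in E -> f (u i) = label E i.
Proof.
move=> SE; pose P i := (i \in E) && `[< Ones (upto E i) >].
have [exP|noP] := pselect (exists i, P i); last first.
  exists (fun=> 0); split=> [|i iE]; first exact: functional_zero.
  rewrite /label; case: ifP => // li; exfalso; apply: noP; exists i.
  by rewrite /P iE.
have Pb i : P i -> (i <= \max_(j <- E) j)%N.
  by move=> /andP[iE _]; exact: (@leq_bigmax_seq _ _ xpredT id).
case: (ex_maxnP exP Pb) => p /andP[pE /asboolP lp] pmax.
have labelE i : i \in E -> label E i = if (i <= p)%N then 1 else 0.
  move=> iE; rewrite /label; case: (leqP i p) => ip.
    suff -> : `[< Ones (upto E i) >] by [].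
    apply/asboolP; have := Ones_upto i lp; congr Ones.
    by apply/fsetP => j; rewrite !in_upto; apply/andP/andP; lia.
  case: ifP => // li; have := pmax i; rewrite /P iE li => /(_ isT).
  by rewrite leqNgt ip.
have [|f fC fu] := @helly_extension _ _ F _ _ E u (label E) C (fset_uniq E) C0.
  move=> a; apply: le_trans (summing a p SE).
  rewrite [X in _ <= abs X]big_mkcond !big_seq.
  rewrite (eq_bigr (fun i => if (i <= p)%N then a i else 0))// => i iE.
  by rewrite labelE//; case: ifP; rewrite ?mulr1 ?mulr0.
by exists f.
Qed.

Let leaf E : Y -> K :=
  xget (fun=> 0) [set f | functional F C f /\ forall i, i \in E -> f (u i) = label E i].

Let leafP E : S E ->
  functional F C (leaf E) /\ forall i, i \in E -> leaf E (u i) = label E i.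
Proof.
by move=> /leaf_functional[f fP]; exact: (@xgetPex _ (fun=> 0) (fun f => _ /\ _) (ex_intro _ f fP)).
Qed.

Let step s (rec : forall t, child t s -> Y -> K) (v : Y) : K :=
  if pselect (exists n, extends_by s n) then
    ulim F V (fun n => if pselect (child (n |` s)%fset s) is left c
      then rec (n |` s)%fset c v else 0)
  else leaf s v.

(** The functional at a node is the weak-star limit, along the ultrafilter, of the
    functionals at its children; a maximal node carries the functional given by
    the Hahn-Banach theorem. *)
Definition tree : {fset nat} -> Y -> K := Fix child_wf (fun=> Y -> K) step.

Lemma treeE s v : tree s v = if pselect (exists n, extends_by s n) then
    ulim F V (fun n => if pselect (child (n |` s)%fset s) is left c
      then tree (n |` s)%fset v else 0)
  else leaf s v.
Proof.
rewrite /tree Fix_eq// => t f g fg; apply/funext => w; rewrite /step.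
case: pselect => // ex; congr ulim; apply/funext => n.
by case: pselect => // c; rewrite fg.
Qed.

Lemma tree_spec s : S s -> [/\ functional F C (tree s),
  forall i, i \in s -> tree s (u i) = label s i &
  forall n, extends_by s n ->
    forall v, tends F V (fun m => tree (m |` s)%fset v) (tree s v)].
Proof.
elim/(well_founded_ind child_wf): s => s IH Ss.
have [[n sn]|ns] := pselect (exists n, extends_by s n); last first.
  have -> : tree s = leaf s.
    by apply/funext => v; rewrite treeE; case: pselect.
  have [lC lu] := leafP Ss; split=> // n sn; exfalso; apply: ns; by exists n.
pose f n := if pselect (child (n |` s)%fset s) then tree (n |` s)%fset else fun=> 0.
have fC m : functional F C (f m).
  rewrite /f; case: pselect => [c|nc]; last exact: functional_zero.
  by have [|//] := IH _ c; case: c => k [-> []].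
have treef : tree s = fun v => ulim F V (f^~ v).
  apply/funext => v; rewrite treeE; case: pselect => [ex|ns]; last first.
    by exfalso; apply: ns; exists n.
  congr ulim; apply/funext => m; rewrite /f.
  by case: pselect.
have [limC lim] := functional_ulim UV fC.
have fE : V [set m | f m = tree (m |` s)%fset /\ extends_by s m].
  apply: filterS (V_infinite n) => m /= nm; have sm := extends_by_leq sn nm.
  split=> //; rewrite /f; case: pselect => // nc; exfalso; apply: nc.
  by exists m.
split; first by rewrite treef.
  move=> i si; rewrite treef; apply: (tends_unique (lim _)).
  have cst : tends F V (fun=> label s i) (label s i) by exact: tends_cst.
  apply: tends_near cst; apply: filterS fE => m /= [-> sm].
  have cm : child (m |` s)%fset s by exists m.
  have [_ mu _] := IH _ cm sm.2.
  by rewrite mu ?label_extend ?inE ?si ?orbT//; exact: sm.1.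
move=> _ _ v; rewrite treef.
apply: tends_near (lim v); apply: filterS fE => m /= [-> _]; exact: erefl.
Qed.

Section Selection.
Variables (eta : R) (eta0 : 0 < eta).

Let eta_ j := eta * 2^-1 ^+ j.+1.

Let good (h : seq nat) (n : nat) :=
  [/\ forall i, i \in h -> (i < n)%N, (size h < n)%N &
  forall s, {subset s <= h} -> S s ->
    abs (tree s (u n) - tree s y) <= eta_ (size h) /\
    (S (n |` s)%fset -> forall v, v \in y :: map u h ->
      abs (tree (n |` s)%fset v - tree s v) <= eta_ (size h))].

Let good_exists h : exists n, good h n.
Proof.
have eh0 : 0 < eta_ (size h) by rewrite mulr_gt0// exprn_gt0// invr_gt0.
pose hs := fpowerset [fset x in h]%fset.
pose Q s : set nat := [set n | S s ->
    abs (tree s (u n) - tree s y) <= eta_ (size h) /\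
    (S (n |` s)%fset -> forall v, v \in y :: map u h ->
      abs (tree (n |` s)%fset v - tree s v) <= eta_ (size h))].
have VQ : V [set n | forall s, s \in enum_fset hs -> Q s n].
  apply: filter_seq => s; rewrite fpowersetE => /fsubsetP sh.
  have [Ss|nSs] := pselect (S s); last by apply: filterS filterT => n _ /nSs.
  have [sC _ slim] := tree_spec Ss.
  have V1 := weak_limit sC eh0.
  suff V2 : V [set n | S (n |` s)%fset -> forall v, v \in y :: map u h ->
      abs (tree (n |` s)%fset v - tree s v) <= eta_ (size h)].
    by apply: filterS (filterI V1 V2) => n [/= /ltW h1 h2] _.
  have [[n sn]|ns] := pselect (exists n, extends_by s n).
    have FV : Filter V by exact: filter_filter.
    have := @filter_seq _ _ V
      (fun v => [set m | abs (tree (m |` s)%fset v - tree s v) < eta_ (size h)])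
      (y :: map u h) FV (fun v _ => slim n sn v _ eh0).
    by apply: filterS => m /= h1 _ v /h1/ltW.
  apply: filterS (V_infinite (\max_(i <- h) i).+1) => n /= hn Sn.
  exfalso; apply: ns; exists n; split=> // i si; apply: leq_ltn_trans hn.
  by apply: (@leq_bigmax_seq _ _ xpredT id) => //; have := sh i si; rewrite inE.
pose b := maxn (\max_(i <- h) i).+1 (size h).+1.
have [n [/= nQ nb]] := filter_ex (filterI VQ (V_infinite b)).
exists n; split.
- move=> i ih; apply: leq_trans nb; rewrite leq_max; apply/orP; left.
  by rewrite ltnS (@leq_bigmax_seq _ _ xpredT id).
- by apply: leq_trans nb; rewrite leq_maxr.
- move=> s sh Ss; apply: nQ => //; rewrite fpowersetE; apply/fsubsetP => i si.
  by rewrite inE; exact: sh.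
Qed.

(** A term of [r] is chosen where the functionals at the finitely many nodes formed
    by the previous terms have almost reached their limits. Adding the elements of
    a node one after the other then changes the value at [y], and at a vector
    outside the node, very little in total. *)
Lemma generic_functionals : exists (c : K) (r : nat -> nat),
  [/\ {homo r : i j / (i < j)%N}, forall j, (j < r j)%N &
  forall s, S s -> (forall i, i \in s -> exists l, i = r l) ->
    exists f, [/\ functional F C f, forall i, i \in s -> f (u i) = label s i &
      forall i, r i \notin s -> abs (f (u (r i)) - c) <= 3 * eta]].
Proof.
have [r rP] := history_choice good_exists.
have rlt j : (j < r j)%N by have [_] := rP j; rewrite size_mkseq.
have rmono : {homo r : i j / (i < j)%N}.
  move=> i j ij; have [+ _ _] := rP j; apply.
  by apply/mapP; exists i; rewrite // mem_iota.
have rstep j s (sj : {subset s <= mkseq r j}) (Ss : S s) :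
  abs (tree s (u (r j)) - tree s y) <= eta_ j /\
  (S (r j |` s)%fset -> forall v, v \in y :: map u (mkseq r j) ->
      abs (tree (r j |` s)%fset v - tree s v) <= eta_ j).
  by have [_ _] := rP j; rewrite size_mkseq; exact.
pose c := tree fset0 y; exists c, r; split=> //.
have splitS k s : S s -> {subset s <= mkseq r k.+1} ->
    {subset s <= mkseq r k} \/ exists s', [/\ s = (r k |` s')%fset, S s' &
      {subset s' <= mkseq r k}].
  move=> Ss sk; case rs : (r k \in s); [right|left].
    exists (s `\ r k)%fset; split; first by rewrite fsetD1K.
      by apply: hereditary Ss => //; exact: fsubD1set.
    move=> i; rewrite !inE => /andP[ik /sk]; rewrite mkseqS mem_rcons inE.
    by rewrite (negPf ik).
  move=> i si; have := sk i si; rewrite mkseqS mem_rcons inE => /predU1P[ik|//].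
  by rewrite ik rs in si.
pose tot k := \sum_(0 <= l < k) eta_ l.
have totS k : tot k.+1 = tot k + eta_ k by rewrite /tot big_nat_recr.
have eta_ge0 k : 0 <= eta_ k by rewrite mulr_ge0 ?(ltW eta0)// exprn_ge0// invr_ge0.
have tot_ge0 k : 0 <= tot k by apply: sumr_ge0 => l _.
have tot_le k : tot k <= eta.
  by rewrite /tot -mulr_sumr ler_piMr ?(ltW eta0)// sum_half_powers.
have at_y k s : S s -> {subset s <= mkseq r k} -> abs (tree s y - c) <= tot k.
  elim: k s => [|k IH] s Ss sk.
    have -> : s = fset0.
      by apply/fsetP => i; rewrite inE; apply/negP => /sk.
    by rewrite subrr abs0.
  rewrite totS; case: (splitS _ _ Ss sk) => [{}sk|[s' [ss' Ss' sk']]].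
    by apply: le_trans (IH _ Ss sk) _; rewrite lerDl.
  have [_] := rstep k s' sk' Ss'; rewrite -ss' => /(_ Ss y (mem_head _ _)).
  have := IH s' Ss' sk'; have := absD F (tree s y - tree s' y) (tree s' y - c).
  rewrite addrA subrK; lra.
have off i k s : (i < k)%N -> S s -> {subset s <= mkseq r k} -> r i \notin s ->
    abs (tree s (u (r i)) - tree s y) <= 2 * tot k.
  elim: k s => // k IH s; rewrite ltnS leq_eqVlt => ik Ss sk ris; rewrite totS.
  case: (splitS _ _ Ss sk) => [{}sk|[s' [ss' Ss' sk']]].
    case/predU1P: ik => [->|ik].
      have [h _] := rstep k s sk Ss; have := tot_ge0 k; have := eta_ge0 k; lra.
    by apply: le_trans (IH _ ik Ss sk ris) _; have := eta_ge0 k; lra.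
  case/predU1P: ik => [ik|ik]; first by move: ris; rewrite ik ss' !inE eqxx.
  have ris' : r i \notin s' by apply: contra ris; rewrite ss' !inE => ->; rewrite orbT.
  have [_] := rstep k s' sk' Ss'; rewrite -ss' => /(_ Ss) h.
  have h1 := h y (mem_head _ _).
  have h2 : abs (tree s (u (r i)) - tree s' (u (r i))) <= eta_ k.
    apply: h; rewrite inE; apply/orP; right; apply/map_f/mapP; exists i => //.
    by rewrite mem_iota.
  have := IH s' ik Ss' sk' ris'.
  have := absD F (tree s (u (r i)) - tree s' (u (r i))) (tree s' (u (r i)) - tree s y).
  have := absB F (tree s' (u (r i)) - tree s' y) (tree s y - tree s' y).
  rewrite opprB !addrA !subrK; lra.
move=> s Ss sr; have [sC su _] := tree_spec Ss; exists (tree s); split=> // i ris.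
pose k := maxn (\max_(j <- s) j) i.+1.
have sk : {subset s <= mkseq r k}.
  move=> j js; have [l jl] := sr j js; rewrite jl; apply: map_f; rewrite mem_iota/=.
  apply: (leq_trans (rlt l)); rewrite -jl /k leq_max.
  by rewrite (@leq_bigmax_seq _ _ xpredT id).
have ik : (i < k)%N by rewrite /k leq_maxr.
have := off i k s ik Ss sk ris; have := at_y k s Ss sk; have := tot_le k.
have := absD F (tree s (u (r i)) - tree s y) (tree s y - c).
rewrite addrA subrK; lra.
Qed.

End Selection.
End Functionals.
End Tree.

(** * Fillers *)

Lemma initial0 L : initial L 0 = fset0.
Proof. by apply/fsetP => x; rewrite !inE. Qed.

Lemma initialS L k : initial L k.+1 = (initial L k `|` [fset L k])%fset.
Proof.
apply/fsetP => x; rewrite in_fsetU in_fset1; apply/initialP/orP.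
  case=> i; rewrite ltnS leq_eqVlt => /predU1P[-> ->|ik ->]; first by right.
  by left; apply/initialP; exists i.
by case=> [/initialP[i ik ->]|/eqP->]; [exists i; rewrite // ltnW|exists k].
Qed.

Lemma initial_min L k : {homo L : i j / (i < j)%N} -> fset_min (initial L k.+1) = L 0%N.
Proof.
move=> Lmono; apply: fset_min_unique; first by apply/initialP; exists 0%N.
by move=> _ /initialP[[|i] _ ->]//; exact/ltnW/Lmono.
Qed.

Section Fillers.
Variables (S : set {fset nat}) (Gs : nat -> set {fset nat}).
Hypotheses (rS : regular S) (lS : layered S Gs).
Implicit Types E t : {fset nat}.

(** In these sets all labels will be 1; the other half of the pieces makes room
    for a member of [S] with labels 0. *)
Definition at_most_half E := E = fset0 \/ pieces (fset_min E)./2 (Gs (fset_min E)) E.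

Lemma at_most_half_upto E i : at_most_half E -> at_most_half (upto E i).
Proof.
have [rG _ _] := lS.
have sub : (upto E i `<=` E)%fset by apply/fsubsetP => j; rewrite in_upto => /andP[].
have [->|E0] := eqVneq (upto E i) fset0; first by left.
case=> [E0'|pE]; first by move: sub E0; rewrite E0' fsubset0 => ->.
right; suff -> : fset_min (upto E i) = fset_min E by exact: pieces_hereditary pE.
have := fset_min_in E0; rewrite in_upto => /andP[mE mi].
apply: fset_min_unique => [|j]; last by rewrite in_upto => /andP[/fset_min_le].
rewrite in_upto fset_min_in ?(leq_trans (fset_min_le mE))//.
by apply/fset0Pn; exists (fset_min (upto E i)).
Qed.

Lemma at_most_half_member E : at_most_half E -> S E.
Proof.
have [rG _ lQ] := lS.
have [-> _|E0] := eqVneq E fset0; first exact: regular0.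
move=> [E0'|pE]; first by rewrite E0' eqxx in E0.
apply: lQ => //; apply: pieces_leq pE => //.
by rewrite -{2}[fset_min E]odd_double_half -addnn; lia.
Qed.

(** The set [initial L k.+1] will be the filler: it exceeds the half by one
    element, so that all labels after it are 0. *)
Lemma filler_exists L : {homo L : i j / (i < j)%N} ->
  exists k, at_most_half (initial L k) /\ ~ at_most_half (initial L k.+1).
Proof.
move=> Lmono; have [k0 k0S] := no_infinite_branch rS Lmono.
have ex : exists k, `[< ~ at_most_half (initial L k) >].
  by exists k0; apply/asboolP => /at_most_half_member.
case: (ex_minnP ex) => -[|k] /asboolP hk kmin.
  by exfalso; apply: hk; left; exact: initial0.
exists k; split=> //; apply: contrapT => nk.
by have := kmin k (introT (asboolP _) nk); rewrite ltnn.
Qed.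

Section Image.
Variables (t : {fset nat}) (f : nat -> nat).
Hypotheses (St : S t) (t0 : t != fset0).
Hypotheses (fmono : {homo f : i j / (i < j)%N}) (f2 : forall i, (i.*2 <= f i)%N).
Let ft := [fset f i | i in t]%fset.

Lemma image_pieces r : (fset_min t <= r)%N -> pieces (fset_min t) (Gs r) ft.
Proof.
have [rG lP _] := lS; move=> tr.
apply: pieces_spreading => //; last exact: lP.
  by move=> i j _ _; exact: fmono.
by move=> i _; apply: leq_trans (f2 i); rewrite -addnn leq_addr.
Qed.

Lemma image_at_most_half : at_most_half ft.
Proof.
right; have [rG _ _] := lS.
have ft0 : ft != fset0.
  by apply/fset0Pn; exists (f (fset_min t)); apply/mem_image/fset_min_in.
have m2 : ((fset_min t).*2 <= fset_min ft)%N.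
  have /imfsetP[i /= it ->] := fset_min_in ft0.
  by apply: leq_trans (f2 i); rewrite leq_double; exact: fset_min_le.
apply: pieces_leq (image_pieces _) => //; last first.
  by apply: leq_trans m2; rewrite -addnn leq_addr.
by rewrite -(doubleK (fset_min t)); exact: half_leq.
Qed.

Section Filled.
Variables (L : nat -> nat) (k : nat).
Hypotheses (Lmono : {homo L : i j / (i < j)%N}).
Hypothesis (hk : at_most_half (initial L k)).
Hypothesis (L0 : ((fset_min t).*2.+2 <= L 0)%N).
Hypothesis (Lf : (L k < f (fset_min t))%N).
Let H := initial L k.+1.

Let Hlt : fset_lt H ft.
Proof.
move=> x _ /initialP[i ik ->] /imfsetP[j /= jt ->].
apply: (@leq_ltn_trans (L k)).
  by move: ik; rewrite ltnS leq_eqVlt => /predU1P[->//|/Lmono/ltnW].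
apply: leq_trans Lf _; have := fset_min_le jt.
by rewrite leq_eqVlt => /predU1P[->//|/fmono/ltnW].
Qed.

Let Hmin : fset_min H = L 0%N. Proof. exact: initial_min. Qed.

Let m0 : L 0%N \in H. Proof. by apply/initialP; exists 0%N. Qed.

Lemma filled_min E : (H `<=` E)%fset -> (E `<=` H `|` ft)%fset -> fset_min E = L 0%N.
Proof.
move=> /fsubsetP HE /fsubsetP EH; apply: fset_min_unique; first exact: HE.
move=> i /EH; rewrite inE => /orP[/fset_min_le|it]; first by rewrite Hmin.
exact/ltnW/Hlt.
Qed.

(** Half of the available pieces, one singleton and the pieces of the image still
    make up a member of [S]. *)
Lemma filled_member : S (H `|` ft)%fset.
Proof.
have [rG _ lQ] := lS.
apply: lQ; first by apply/fset0Pn; exists (L 0%N); rewrite inE m0.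
rewrite (@filled_min (H `|` ft)%fset) ?fsubsetUl//.
have p1 : pieces (L 0%N)./2 (Gs (L 0%N)) (initial L k).
  case: hk => [->|]; first exact: pieces0.
  by case: (k) => [|k']; [rewrite initial0 => _; exact: pieces0|rewrite initial_min].
have Lk0 : (0 < L k)%N.
  apply: leq_trans (leq_trans L0 _); first by [].
  by case: (k) => // k'; exact/ltnW/Lmono.
have p2 : pieces 1 (Gs (L 0%N)) [fset L k]%fset.
  by apply: pieces1; exact: singletons (rG _) _ Lk0.
have p3 : pieces (fset_min t) (Gs (L 0%N)) ft.
  by apply: image_pieces; apply: leq_trans L0; rewrite -addnn; lia.
have p12 : pieces ((L 0%N)./2 + 1) (Gs (L 0%N)) H.
  rewrite /H initialS; apply: pieces_cat p1 p2 _.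
  by move=> x z /initialP[i ik ->]; rewrite inE => /eqP->; exact: Lmono.
apply: (@pieces_leq _ (rG _)) (pieces_cat p12 p3 Hlt).
by have := odd_double_half (L 0%N); move: L0; rewrite -!addnn; lia.
Qed.

Hypothesis nH : ~ at_most_half H.

Lemma filled_not_at_most_half E : (H `<=` E)%fset -> (E `<=` H `|` ft)%fset -> ~ at_most_half E.
Proof.
have [rG _ _] := lS.
move=> HE EH hE; apply: nH; right; case: hE => [E0|].
  by move: HE m0; rewrite E0 fsubset0 => /eqP ->; rewrite inE.
by rewrite (filled_min HE EH) Hmin; exact: pieces_hereditary.
Qed.

End Filled.
End Image.
End Fillers.

(** * The lower l1 estimate *)

Section LowerEstimate.
Variables (R : realType) (K : numFieldType) (F : real_coordinates R K).
Local Notation re := (rpart F).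
Local Notation abs := (abs F).
Local Notation N := (rnorm F).

Lemma positive_subsum (h : K -> R) (E : {fset nat}) (a : nat -> K) :
  (forall x y, h (x + y) = h x + h y) -> h 0 = 0 -> (forall z, h z <= abs z) ->
  \sum_(i <- E) Num.max (h (a i)) 0 <=
  abs (\sum_(i <- [fset i in E | (0 < h (a i))%R]%fset) a i).
Proof.
move=> hD h0 hle; apply: le_trans (hle _).
rewrite (big_morph h hD h0) big_fset/= [leRHS]big_mkcond; apply: ler_sum => i _.
by case: ltP.
Qed.

(** One of the four quadrants carries a quarter of the l1 norm. *)
Lemma large_subsum (E : {fset nat}) (a : nat -> K) : exists t : {fset nat},
  (t `<=` E)%fset /\ \sum_(i <- E) abs (a i) <= 4 * abs (\sum_(i <- t) a i).
Proof.
pose h (j : nat) z := match j with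
  | 0 => re z | 1 => - re z | 2 => re (rot F * z) | _ => - re (rot F * z) end.
pose t j := [fset i in E | (0 < h j (a i))%R]%fset.
have ht j : \sum_(i <- E) Num.max (h j (a i)) 0 <= abs (\sum_(i <- t j) a i).
  apply: positive_subsum.
  - by case: j => [|[|[|j]]] x z /=; rewrite ?mulrDr rpartD ?opprD.
  - by case: j => [|[|[|j]]] /=; rewrite ?mulr0 re0 ?oppr0.
  - have uz z : abs (rot F * z) <= abs z.
      by rewrite absM ler_piMl ?abs_ge0 ?abs_rot.
    case: j => [|[|[|j]]] z /=; rewrite -?reN.
    + exact: re_abs.
    + by rewrite -[leRHS]absN; exact: re_abs.
    + exact: le_trans (re_abs _ _) (uz z).
    + apply: le_trans (re_abs _ _) _; rewrite absN; exact: uz.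
have tot : \sum_(i <- E) abs (a i) <= \sum_(i <- E) Num.max (h 0 (a i)) 0 +
    \sum_(i <- E) Num.max (h 1 (a i)) 0 + \sum_(i <- E) Num.max (h 2 (a i)) 0 +
    \sum_(i <- E) Num.max (h 3 (a i)) 0.
  rewrite -!big_split/=; apply: ler_sum => i _.
  apply: le_trans (abs_coordinates F _) _; rewrite -addrA.
  have nE (z : R) : `|z| <= Num.max z 0 + Num.max (- z) 0.
    have h1 : z <= Num.max z 0 /\ 0 <= Num.max z 0 by rewrite !le_max !lexx orbT.
    have h2 : - z <= Num.max (- z) 0 /\ 0 <= Num.max (- z) 0 by rewrite !le_max !lexx orbT.
    by case: h1 h2 => h1 h2 [h3 h4]; rewrite ler_norml; apply/andP; split; lra.
  by apply: lerD; exact: nE.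
have tE j : (t j `<=` E)%fset by apply/fsubsetP => i; rewrite !inE => /andP[].
apply: contrapT => no.
have small j : 4 * abs (\sum_(i <- t j) a i) < \sum_(i <- E) abs (a i).
  by rewrite ltNge; apply/negP => ge; apply: no; exists (t j).
have := small 0%N; have := small 1%N; have := small 2%N; have := small 3%N.
have := ht 0%N; have := ht 1%N; have := ht 2%N; have := ht 3%N; lra.
Qed.

Variables (S : set {fset nat}) (Gs : nat -> set {fset nat}).
Hypotheses (rS : regular S) (lS : layered S Gs).
Variables (Y : normedModType K) (u : nat -> Y) (y : Y) (C : R) (V : set_system nat).
Hypotheses (UV : UltraFilter V) (V_infinite : forall n, V [set m | (n <= m)%N]).
Hypothesis C0 : 0 < C.
Hypothesis summing : forall E (a : nat -> K) p, S E ->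
  abs (\sum_(i <- E | (i <= p)%N) a i) <= C * N (\sum_(i <- E) a i *: u i).
Hypothesis weak_limit : forall f, functional F C f ->
  tends F V (fun n => f (u n)) (f y).

Lemma differences_l1 : exists (f : nat -> nat) (n0 : nat) (rho : R),
  [/\ forall i, (0 < f i)%N, (0 < n0)%N, 0 < rho &
  forall (E : {fset nat}) (a : nat -> K), S E ->
    rho * \sum_(i <- E) abs (a i) <= N (\sum_(i <- E) a i *: (u (f i) - u n0))].
Proof.
(* The total error is 6 * eta = 1/16, half of the main term 1/2 * 1/4. *)
pose eta : R := 96^-1; have eta0 : 0 < eta by rewrite invr_gt0.
have [c [r [rmono rlt rP]]] := @generic_functionals _ _ F S (at_most_half Gs) rS
  (@at_most_half_upto _ _ lS) Y u y C V UV V_infinite (ltW C0) summing weak_limit eta eta0.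
have Lmono j : {homo (fun l => r (j + l)%N) : i k / (i < k)%N}.
  by move=> i k ik; apply: rmono; rewrite ltn_add2l.
have /choice[fill fillP] j := filler_exists rS lS (Lmono j).
pose jj := fix jj i := if i is i'.+1 then (jj i' + fill (jj i') + 4)%N else 2%N.
(* The filler for i occupies the places from jj i to tau i - 1 of the sequence r,
   and f i sits at the place tau i. *)
pose tau i := (jj i + fill (jj i)).+1.
have jj2 i : (i.*2.+2 <= jj i)%N by elim: i => //= i IH; rewrite doubleS; lia.
have tau_jj i : (jj i < tau i)%N by rewrite /tau ltnS leq_addr.
have jj_tau i : (tau i < jj i.+1)%N by rewrite /tau/=; lia.
have taumono : {homo tau : i j / (i < j)%N}.
  apply: homo_ltn; first exact: ltn_trans.
  by move=> i; exact: ltn_trans (jj_tau i) (tau_jj _).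
have rinj i j : r i = r j -> i = j.
  by move=> rij; case: (ltngtP i j) => // /rmono; rewrite rij ltnn.
pose f i := r (tau i).
have fmono : {homo f : i j / (i < j)%N} by move=> i j /taumono/rmono.
have f2 i : (i.*2 <= f i)%N.
  have := rlt (tau i); rewrite -/(f i); have := jj2 i; have := tau_jj i; lia.
have finj i j : f i = f j -> i = j.
  by move=> fij; case: (ltngtP i j) => // /fmono; rewrite fij ltnn.
(* Either the value c off the node is far from 1, and nodes with all labels 1
   serve, or it is far from 0, and a filler makes the labels vanish. *)
have key (t : {fset nat}) : S t -> t != fset0 -> exists (l : K) (g : Y -> K),
    [/\ functional F C g, 2^-1 <= abs (l - c), forall i, i \in t -> g (u (f i)) = l,
      forall i, i \notin t -> abs (g (u (f i)) - c) <= 3 * eta &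
      abs (g (u (r 0%N)) - c) <= 3 * eta].
  move=> St t0; pose ft := [fset f i | i in t]%fset.
  have ftr i : i \in ft -> exists l, i = r l.
    by move=> /imfsetP[k _ ->]; exists (tau k).
  have nft i : i \notin t -> f i \notin ft.
    by apply: contra => /imfsetP[k /= kt /finj->].
  have r0ft : r 0%N \notin ft.
    by apply/negP => /imfsetP[k _ /rinj].
  case: (lerP 2^-1 (abs (1 - c))) => c1.
    have hft := image_at_most_half lS St t0 fmono f2.
    have [g [gC gl goff]] := rP ft (at_most_half_member rS lS hft) ftr.
    exists 1, g; split=> //.
    - move=> i it; rewrite gl; last exact: mem_image.
      by rewrite /label; case: asboolP => // nh; exfalso; exact/nh/(at_most_half_upto lS).
    - by move=> i /nft; exact: goff.
    - exact: goff.
  pose j := jj (fset_min t); pose L l := r (j + l)%N; pose k := fill j.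
  have [hk nH] := fillP j.
  have L0 : ((fset_min t).*2.+2 <= L 0)%N.
    rewrite /L addn0; apply: leq_trans (jj2 _) _; exact/ltnW/rlt.
  have Lf : (L k < f (fset_min t))%N by exact: rmono.
  pose H := initial L k.+1.
  have SH : S (H `|` ft)%fset := filled_member lS St t0 fmono f2 (Lmono j) hk L0 Lf.
  have Hr i : i \in (H `|` ft)%fset -> exists l, i = r l.
    by rewrite in_fsetU => /orP[/initialP[l _ ->]|/ftr//]; exists (j + l)%N.
  have [g [gC gl goff]] := rP _ SH Hr.
  have Hout l : (l < j)%N \/ (j + k < l)%N -> r l \notin H.
    by move=> lj; apply/negP => /initialP[i ik /rinj]; lia.
  exists 0, g; split=> //.
  - rewrite sub0r absN; have := absD F (1 - c) c; rewrite subrK abs1; lra.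
  - move=> i it; rewrite gl; last by rewrite inE mem_image ?orbT.
    rewrite /label; case: asboolP => // hE; exfalso.
    apply: (filled_not_at_most_half lS fmono (Lmono j) Lf nH _ _ hE).
      apply/fsubsetP => x xH; rewrite in_upto inE xH/=.
      move: xH => /initialP[l lk ->].
      apply: (@leq_trans (L k)).
        by move: lk; rewrite ltnS leq_eqVlt => /predU1P[->//|/(Lmono j)/ltnW].
      apply: (leq_trans (ltnW Lf)); have := fset_min_le it.
      by rewrite leq_eqVlt => /predU1P[->//|/fmono/ltnW].
    by apply/fsubsetP => x; rewrite in_upto => /andP[].
  - move=> i it; apply: goff; rewrite inE negb_or nft// andbT; apply: Hout.
    case: (leqP (fset_min t) i) => ti; last first.
      left; rewrite /j.
      have : (tau i < jj (fset_min t))%N; last by [].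
      case: (fset_min t) ti => // m; rewrite ltnS leq_eqVlt => /predU1P[->//|im].
      exact: ltn_trans (taumono _ _ im) (jj_tau m).
    right; rewrite -ltnS -/(tau (fset_min t)).
    by move: ti; rewrite leq_eqVlt => /predU1P[->//|/taumono/leqW].
  - apply: goff; rewrite inE negb_or r0ft andbT; apply: Hout; left.
    by apply: leq_trans (jj2 _).
exists f, (r 0%N), (16 * C)^-1; split.
- by move=> i; apply: leq_trans (rlt _).
- exact: leq_trans (rlt 0%N).
- by rewrite invr_gt0 mulr_gt0.
move=> E a SE; rewrite ler_pdivrMl ?mulr_gt0//.
set T := \sum_(i <- E) abs (a i); set w := \sum_(i <- E) _.
have T0 : 0 <= T by apply: sumr_ge0 => i _; exact: abs_ge0.
have [t [tE tT]] := large_subsum E a; rewrite -/T in tT.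
have [t0|t0] := eqVneq t fset0.
  move: tT; rewrite t0 big_seq_fset0 abs0 mulr0 => tT; apply: le_trans tT _.
  by rewrite mulr_ge0 ?rnorm_ge0// mulr_ge0// ltW.
have [l [g [gC lc gin gout g0]]] := key t (hereditary rS tE SE) t0.
have gw : abs (g w) <= C * N w by exact: gC.2.
have diff : abs (g w - (l - c) * \sum_(i <- t) a i) <= 6 * eta * T.
  rewrite /w (functional_sum gC).
  have -> : \sum_(i <- t) a i = \sum_(i <- E) (if i \in t then a i else 0).
    rewrite -[RHS]big_mkcond/= -[RHS]big_filter; apply: perm_big; apply: uniq_perm.
    - exact: fset_uniq.
    - exact/filter_uniq/fset_uniq.
    - move=> i; rewrite mem_filter andbC; case it : (i \in t); rewrite ?andbF//.
      by rewrite andbT (fsubsetP tE).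
  rewrite mulr_sumr -sumrB /T mulr_sumr; apply: le_trans (abs_sum _ _ _ _) _.
  apply: ler_sum => i _; rewrite (functionalZ gC) (functionalB gC).
  case: ifP => [it|/negbT it].
    rewrite (gin i it).
    have -> : a i * (l - g (u (r 0%N))) - (l - c) * a i = a i * (c - g (u (r 0%N))).
      by ring.
    rewrite absM mulrC ler_wpM2r ?abs_ge0// abs_distC.
    by apply: le_trans g0 _; lra.
  rewrite mulr0 subr0 absM mulrC ler_wpM2r ?abs_ge0//.
  have := absB F (g (u (f i)) - c) (g (u (r 0%N)) - c).
  by rewrite opprB addrA subrK; have := gout i it; lra.
have : 2^-1 * abs (\sum_(i <- t) a i) <= abs ((l - c) * \sum_(i <- t) a i).
  by rewrite absM ler_wpM2r ?abs_ge0.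
have := absB F (g w) (g w - (l - c) * \sum_(i <- t) a i); rewrite subKr.
have e6 : 6 * eta * T = 16^-1 * T by rewrite /eta; field.
rewrite e6 in diff; lra.
Qed.

End LowerEstimate.

Section Converse.
Variables (R : realType) (K : numFieldType) (F : real_coordinates R K).
Local Notation abs := (abs F).
Local Notation N := (rnorm F).
Variables (X Y : normedModType K) (A : {linear X -> Y}).

Theorem WC_S_weakly_compact (S : set {fset nat}) Gs : regular S -> layered S Gs ->
  bounded_operator A -> WC S A -> S_weakly_compact S A.
Proof.
move=> rS lS /(bounded_operatorP F)[M M0 AM] [Awc Al1].
apply/(S_weakly_compactP F) => x /(seminormalizedP F)[c [B [c0 B0 xB]]] _ e e0.
apply: contrapT => no.
have summing (E : {fset nat}) (a : nat -> K) p : S E ->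
    abs (\sum_(i <- E | (i <= p)%N) a i) <= e^-1 * N (\sum_(i <- E) a i *: A (x i)).
  move=> SE; rewrite ler_pdivlMl//.
  have : e * snorm F E a <= N (\sum_(i <- E) a i *: A (x i)).
    by rewrite leNgt; apply/negP => h; apply: no; exists E, a.
  apply: le_trans; rewrite ler_wpM2l ?(ltW e0)//; apply: le_snorm; exact: positive SE.
have [V [UV V_infinite]] := nat_ultrafilter.
pose BK := emb F B; have BK0 : BK != 0 by rewrite fmorph_eq0 gt_eqF.
have [|y0 y0P] := @weakly_compact_limit _ _ F Y _ nat V (fun n => A (BK^-1 *: x n)) Awc UV.
  apply: filterS (V_infinite 1%N) => n /= n0; exists (BK^-1 *: x n) => //=.
  rewrite (rnormE F) -(rmorph1 (emb F)) emb_le rnormZ /BK -fmorphV.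
  rewrite abs_emb ?invr_ge0 ?(ltW B0)// ler_pdivrMl// mulr1.
  by case: (xB n n0).
have eV0 : 0 < e^-1 by rewrite invr_gt0.
have weak_limit f : functional F e^-1 f ->
    tends F V (fun n => f (A (x n))) (f (BK *: y0)).
  move=> fe; have [D DE] := functional_dual fe.
  have FV : Filter V by exact: filter_filter.
  have := @tendsZ _ _ F _ V FV _ BK _ (y0P D).
  rewrite (functionalZ fe) DE; apply: tends_near.
  apply: filterS filterT => n _ /=.
  by rewrite DE linearZ (functionalZ fe) mulrA mulfV// mul1r.
have [f [n0 [rho [f0 n00 rho0 fl1]]]] := differences_l1 rS lS UV V_infinite eV0 summing weak_limit.
pose w i := x (f i) - x n0.
have wB i : N (w i) <= B + B.
  apply: le_trans (rnormB _ _ _) _; apply: lerD; first by case: (xB _ (f0 i)).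
  by case: (xB _ n00).
have Aw i : A (w i) = A (x (f i)) - A (x n0) by rewrite linearB.
have lower (E : {fset nat}) (a : nat -> K) : S E ->
    rho * \sum_(i <- E) abs (a i) <= N (\sum_(i <- E) a i *: A (w i)).
  move=> /(fl1 E a); congr (_ <= N _); apply: eq_bigr => i _; by rewrite Aw.
have BB : 0 < B + B by rewrite addr_gt0.
apply: (Al1 w); apply/(l1_spreading_modelP F).
  exists (M / rho), (B + B); split=> //; first by rewrite divr_gt0.
  move=> E a SE; split; last first.
    apply: (bounded_sequence_l1 (ltW BB) _ _ _ SE) => [E'|n _]; [exact: positive|exact: wB].
  rewrite mulrAC ler_pdivlMr// mulrC; apply: le_trans (lower E a SE) _.
  apply: le_trans (AM _); rewrite linear_sum.
  by rewrite [X in _ <= N X](eq_bigr (fun i => a i *: A (w i)))// => i _; rewrite linearZ.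
exists rho^-1, (M * (B + B)); split; [by rewrite invr_gt0|by rewrite mulr_gt0|].
move=> E a SE; split; first by rewrite ler_pdivlMl//; exact: lower.
apply: (bounded_sequence_l1 _ _ _ _ SE) => [|E'|n _].
- by rewrite mulr_ge0// ltW.
- exact: positive.
- by apply: le_trans (AM _) _; rewrite ler_wpM2l ?(ltW M0).
Qed.

End Converse.

Lemma layered_pair (G : set {fset nat}) Gs : layered G Gs ->
  forall n m, (1 < n)%N -> (n < m)%N -> G [fset n; m]%fset.
Proof.
move=> [rG _ lQ] n m n1 nm.
have mE : fset_min [fset n; m]%fset = n.
  apply: fset_min_unique; first by rewrite !inE eqxx.
  by move=> i; rewrite !inE => /orP[]/eqP->//; exact: ltnW.
apply: lQ; first by apply/fset0Pn; exists n; rewrite !inE eqxx.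
rewrite mE; apply: (@pieces_leq _ (rG n) (1 + 1)) => //.
apply: pieces_cat; [| |by move=> i j; rewrite !inE => /eqP-> /eqP->].
  by apply: pieces1; apply: singletons (rG n) _ _; exact: ltnW.
by apply: pieces1; apply: singletons (rG n) _ _; exact: leq_ltn_trans nm.
Qed.

Lemma S_weakly_compact_WC (R : realType) (K : numFieldType) (F : real_coordinates R K)
    (S : set {fset nat}) Gs :
  regular S -> doubling S -> layered S Gs ->
  forall (X Y : completeNormedModType K) (A : {linear X -> Y}),
    bounded_operator A -> (S_weakly_compact S A <-> WC S A).
Proof.
move=> rS dS lS X Y A Ab; split; last exact: (WC_S_weakly_compact F rS lS).
move=> SA; split.
  by apply: (S_weakly_compact_weakly_compact F _ Ab SA) => E; exact: positive.
exact: (S_weakly_compact_no_l1 F rS dS (layered_pair lS) SA).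
Qed.

Lemma real_field_coordinates (R : realType) : real_coordinates R R.
Proof.
refine (@RealCoordinates R R id idfun 0 1 _ _ _ _ _ _ _ _ _ _ _).
- by [].
- by [].
- by [].
- by [].
- by [].
- by [].
- by move=> z; rewrite mul0r addr0.
- by move=> r; rewrite mul0r.
- by rewrite normr1.
- by rewrite normr0.
- by left.
Qed.

Lemma complex_field_coordinates (R : realType) : real_coordinates R R[i].
Proof.
refine (@RealCoordinates R R[i] (@complex.Re R) (real_complex R) 'i%C (- 'i%C)
  _ _ _ _ _ _ _ _ _ _ _).
- by case=> a b [c d].
- by move=> r [a b] /=; rewrite mul0r subr0.
- by [].
- by move=> r; rewrite ler0c.
- by move=> z z0; apply: RRe_real; exact: ger0_real.
- by move=> z; have := normc_ge_Re z; rewrite normc_def lecR.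
- move=> z; rewrite {1}(complexE z); congr (_ + _ * _%:C%C).
  by case: z => a b /=; rewrite oppr0 mul0r mulN1r sub0r opprK.
- by move=> r /=; rewrite mulr0 mul0r subr0.
- by rewrite normrN normc_def /= expr0n expr1n add0r sqrtr1.
- by rewrite normc_def /= expr0n expr1n add0r sqrtr1.
- by right; split=> //; rewrite -expr2 sqr_i.
Qed.

Theorem proposition4p5 (R : realType)
  (d : Order.disp_t) (T : orderType d) (T_ordinals : countable_ordinals T)
  (fs : T -> nat -> T) (S : T -> set {fset nat})
  (S_schreier : schreier_hierarchy fs S)
  (xi : T) (xi_gt0 : ~ is_zero xi) :
  (forall (X Y : completeNormedModType R) (A : {linear X -> Y}),
     bounded_operator A ->
     (S_weakly_compact (S xi) A <-> WC (S xi) A)) /\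
  (forall (X Y : completeNormedModType R[i]) (A : {linear X -> Y}),
     bounded_operator A ->
     (S_weakly_compact (S xi) A <-> WC (S xi) A)).
Proof.
have [rS /(_ xi_gt0)[dS [Gs lS]]] := schreier_nice T_ordinals S_schreier xi.
by split; apply: S_weakly_compact_WC rS dS lS;
  [exact: real_field_coordinates|exact: complex_field_coordinates].
Qed.
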